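(* Let $\mathbf A\in\mathbb R^{m\times n}$ have an SVD with singular values $\sigma_1\ge\dots\ge\sigma_n\ge 0$, and let $p$ and $k\ge 1$ be integers with $2\le p\le \ell-k$, where $\sigma_k>0$. Let $\mathbf\Omega\in\mathbb R^{n\times\ell}$ be a standard Gaussian matrix. Put $\gamma_k=\frac{\sigma_{\ell-p+1}}{\sigma_k}$ and $\nu=\nu_1\nu_2$ with $\nu_1=\sqrt{n-\ell+p}+\sqrt{\ell}+7$ and $\nu_2=\frac{4e\sqrt{\ell}}{p+1}$. Let $\varrho\in\{2,F\}$. (i) If $\hat{\mathbf A}_{\mathrm{SOR}}$ is computed by the basic SOR-SVD algorithm from $\mathbf\Omega$, then $$\mathbb E\|\mathbf A-\hat{\mathbf A}_{\mathrm{SOR}}\|_\varrho\le\|\mathbf A_0\|_\varrho+(1+\gamma_k)\sqrt k\,\nu\,\sigma_{\ell-p+1}.$$ (ii) If $\hat{\mathbf A}_{\mathrm{SOR}}$ is computed by the SOR-SVD algorithm with $q$ steps of the power method from $\mathbf\Omega$ ($q\ge 0$ an integer), then $$\mathbb E\|\mathbf A-\hat{\mathbf A}_{\mathrm{SOR}}\|_\varrho\le\|\mathbf A_0\|_\varrho+(1+\gamma_k)\sqrt k\,\nu\,\sigma_{\ell-p+1}\,\gamma_k^{2q}.$$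
   Context: Standing assumptions: $m\ge n>\max\{k,2\}$ and $k\le\ell<n$. $\|\cdot\|_2$ is the spectral norm, $\|\cdot\|_F$ the Frobenius norm. A standard Gaussian matrix has i.i.d. entries with zero mean and unit variance Gaussian distribution; $\mathbb E$ is expectation over $\mathbf\Omega$; $e$ is the base of the natural logarithm. $\mathbf A_k$ is the rank-$k$ truncation of the SVD of $\mathbf A$ (keeping the $k$ leading singular triplets) and $\mathbf A_0=\mathbf A-\mathbf A_k$. SOR-SVD algorithm. Given $\mathbf A$, $k$, $\ell$ and $\mathbf\Omega\in\mathbb R^{n\times\ell}$: in the basic form, set $\mathbf T_1=\mathbf A\mathbf\Omega$, $\mathbf T_2=\mathbf A^T\mathbf T_1$; with $q$ steps of the power method, set $\mathbf T_1=(\mathbf A\mathbf A^T)^q\mathbf A\mathbf\Omega$, $\mathbf T_2=\mathbf A^T\mathbf T_1=(\mathbf A^T\mathbf A)^{q+1}\mathbf\Omega$. Compute QR decompositions $\mathbf T_1=\mathbf Q_1\mathbf R_1$, $\mathbf T_2=\mathbf Q_2\mathbf R_2$ with $\mathbf Q_1\in\mathbb R^{m\times\ell}$, $\mathbf Q_2\in\mathbb R^{n\times\ell}$ having orthonormal columns; set $\mathbf M=\mathbf Q_1^T\mathbf A\mathbf Q_2\in\mathbb R^{\ell\times\ell}$; let $\mathbf M_k=\tilde{\mathbf U}_k\tilde{\mathbf\Sigma}_k\tilde{\mathbf V}_k^T$ be the rank-$k$ truncated SVD of $\mathbf M$. The output is $\hat{\mathbf A}_{\mathrm{SOR}}=(\mathbf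 Q_1\tilde{\mathbf U}_k)\tilde{\mathbf\Sigma}_k(\mathbf Q_2\tilde{\mathbf V}_k)^T=\mathbf Q_1\mathbf M_k\mathbf Q_2^T$. *)

(* Defs.v *)
From HB Require Import structures.
From mathcomp Require Import all_boot all_order all_algebra.
From mathcomp Require Import all_classical all_reals all_analysis.

Set Implicit Arguments.
Unset Strict Implicit.
Unset Printing Implicit Defensive.

Import Order.TTheory GRing.Theory Num.Theory.

Local Open Scope classical_set_scope.
Local Open Scope ring_scope.

Definition frobenius_norm (R : realType) (m n : nat) (A : 'M[R]_(m, n)) : R :=
  Num.sqrt (\sum_i \sum_j A i j ^+ 2).

(* Operator norm induced by the Euclidean norms; on a column vector
   [frobenius_norm] is the Euclidean norm. *)
Definition spectral_norm (R : realType) (m n : nat) (A : 'M[R]_(m, n)) : R :=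
  sup [set frobenius_norm (A *m x) |
       x in [set x : 'cV[R]_n | frobenius_norm x <= 1]].

Variant norm_kind := Spectral | Frobenius.

Definition mxnorm (R : realType) (rho : norm_kind) (m n : nat)
    (A : 'M[R]_(m, n)) : R :=
  match rho with
  | Spectral => spectral_norm A
  | Frobenius => frobenius_norm A
  end.

Definition orthonormal_cols (R : realType) (m n : nat) (Q : 'M[R]_(m, n)) :=
  Q^T *m Q = 1%:M.

(* Thin SVD of a matrix with at least as many rows as columns.  Singular
   vectors, and [svd_trunc] below, are not unique when singular values
   coincide, hence a relation rather than a function. *)
Definition is_svd (R : realType) (m n : nat) (A : 'M[R]_(m, n))
    (U : 'M[R]_(m, n)) (s : n.-tuple R) (V : 'M[R]_n) : Prop :=
  [/\ orthonormal_cols U, orthonormal_cols V,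
      sorted (fun x y => y <= x) s, (forall j : 'I_n, 0 <= tnth s j)
    & A = U *m diag_mx (\row_j tnth s j) *m V^T].

(* 1-based: [singval s 1] is the largest singular value. *)
Definition singval (R : realType) (n : nat) (s : n.-tuple R) (j : nat) : R :=
  s`_j.-1.

Definition svd_trunc (R : realType) (m n : nat) (k : nat)
    (U : 'M[R]_(m, n)) (s : n.-tuple R) (V : 'M[R]_n) : 'M[R]_(m, n) :=
  \sum_(j < n | (j < k)%N) tnth s j *: (col j U *m (col j V)^T).

(* [is_trig_mx] is lower triangularity, hence the transpose. *)
Definition is_qr (R : realType) (m l : nat) (T Q : 'M[R]_(m, l))
    (S : 'M[R]_l) : Prop :=
  [/\ orthonormal_cols Q, is_trig_mx S^T & T = Q *m S].

(* The part of SOR-SVD that follows the computation of T1 and T2.  Any choice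
   of QR decompositions and of an SVD of M is a legitimate run. *)
Definition sor_svd_from (R : realType) (m n l : nat) (k : nat)
    (A : 'M[R]_(m, n)) (T1 : 'M[R]_(m, l)) (T2 : 'M[R]_(n, l))
    (Ahat : 'M[R]_(m, n)) : Prop :=
  exists (Q1 : 'M[R]_(m, l)) (S1 : 'M[R]_l)
         (Q2 : 'M[R]_(n, l)) (S2 : 'M[R]_l)
         (U : 'M[R]_l) (s : l.-tuple R) (V : 'M[R]_l),
    [/\ is_qr T1 Q1 S1, is_qr T2 Q2 S2, is_svd (Q1^T *m A *m Q2) U s V
      & Ahat = Q1 *m svd_trunc k U s V *m Q2^T].

Definition sor_svd (R : realType) (m n l : nat) (k : nat)
    (A : 'M[R]_(m, n)) (Omega : 'M[R]_(n, l)) (Ahat : 'M[R]_(m, n)) : Prop :=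
  let T1 := A *m Omega in
  let T2 := A^T *m T1 in
  sor_svd_from k A T1 T2 Ahat.

Definition sor_svd_power (R : realType) (m n l : nat) (k q : nat)
    (A : 'M[R]_(m, n)) (Omega : 'M[R]_(n, l)) (Ahat : 'M[R]_(m, n)) : Prop :=
  let T1 := (A *m A^T) ^+ q *m A *m Omega in
  let T2 := A^T *m T1 in
  sor_svd_from k A T1 T2 Ahat.

Definition mutually_independent (R : realType) (d : measure_display)
    (T : measurableType d) (P : probability T R) (I : finType)
    (X : I -> {RV P >-> R}) : Prop :=
  forall (J : {set I}) (B : I -> set R), (forall i, measurable (B i)) ->
    P (\bigcap_(i in [set` J]) (X i @^-1` B i)) =
    (\prod_(i in J) P (X i @^-1` B i))%E.

(* The laws are compared on measurable sets only: the value of a measure on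
   other sets is arbitrary. *)
Definition standard_gaussian_mx (R : realType) (d : measure_display)
    (T : measurableType d) (P : probability T R) (n l : nat)
    (Omega : 'I_n -> 'I_l -> {RV P >-> R}) : Prop :=
  mutually_independent (fun ij : 'I_n * 'I_l => Omega ij.1 ij.2) /\
  forall i j (B : set R), measurable B ->
    distribution P (Omega i j) B = normal_prob 0 1 B.

Definition sample_mx (R : realType) (d : measure_display)
    (T : measurableType d) (P : probability T R) (n l : nat)
    (Omega : 'I_n -> 'I_l -> {RV P >-> R}) (w : T) : 'M[R]_(n, l) :=
  \matrix_(i, j) Omega i j w.

(* Main.v *)
(* Write [Om = V^T Omega], which is again a standard Gaussian matrix, [N = l - p],
   [sigma = s_(N+1)] and [gamma = sigma / s_k].

   One run.  Let [P1], [P2] be the projectors onto the ranges of [Q1], [Q2] and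
   [e1], [e2] the Frobenius norms of [(1 - P1) A_k] and [A_k (1 - P2)].  The
   output is the best approximation of [A] of rank [k] among the matrices
   [Q1 Y Q2^T], so comparing it with [P1 A_k P2] gives
   |A - Ahat|_F^2 <= |A_0|_F^2 + (e1 + e2)^2, and a reverse Eckart-Young
   inequality turns this into a bound for the spectral norm.  Vectors [w_j] with
   [(Om w_j)_i = delta_ij] for [i <= N] satisfy
   T1 w_j = s_j^(2q+1) u_j + (a combination of the u_i with i > N),
   hence [e1 <= sigma gamma^(2q) Z] where [Z^2] is the sum of the
   [(Om w_j)_i ^ 2] over [j <= k] and [i > N]; likewise
   [e2 <= sigma gamma^(2q+1) Z].

   Expectation.  Let [r_i] be the rows of [Om] and, for [j <= k], let [g] be the
   component of [r_j] orthogonal to the other first [N] rows; take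
   [w_j = g / |g|^2].  The rows [i > N] are independent of [w_j], so the mean of
   [(Om w_j)_i ^ 2] is of the order of that of [1 / |g|^2].  As [|g|^2] dominates
   a chi-square variable with [p + 1] degrees of freedom, the latter is at most
   [1 / (p - 1)], by
   1 / a = int_(u >= 1) u exp(- (u^2 - 1) a / 2) du  and
   E exp(- (u^2 - 1) Y^2 / 2) = 1 / u  for a standard Gaussian Y. *)
Require Import Defs.
From HB Require Import structures.
From mathcomp Require Import all_boot all_order all_algebra.
From mathcomp Require Import all_classical all_reals all_analysis.
From mathcomp Require Import measurable_realfun ring lra zify.

Set Implicit Arguments.
Unset Strict Implicit.
Unset Printing Implicit Defensive.

Import Order.TTheory GRing.Theory Num.Theory.
Import numFieldNormedType.Exports.

Local Open Scope classical_set_scope.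
Local Open Scope ring_scope.

(** * Frobenius inner product and orthogonal projectors *)

(** The law of [V^T Omega] is found without a density on the space of matrices. Up to signs an
    orthogonal matrix is a product of Givens rotations, each of which mixes two rows. A plane
    rotation is a product of three shears, and a shear is a translation on every line of one
    direction, so Tonelli and the translation invariance of Lebesgue measure suffice.

    The exponential formula for [1 / a] is chosen because the exponential of a sum of squares is a
    product. After Tonelli, independence turns the mean of [1 / a] for [p + 1] coordinates into the
    integral of [u * u^-(p+1)] over [u >= 1], which is [1 / (p - 1)].

    [Ahat] is an arbitrary choice of runs and may fail to be measurable. The error is therefore
    dominated, sample by sample, by a measurable bound. AM-GM makes that bound affine in [Z^2], so
    that only the mean of [Z^2] enters; it is [+oo] on the null event where a dual vector is
    missing. The crude constant 6 bounding a Gaussian second moment is absorbed by the slack in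
    [nu]. *)

Lemma sum_CauchySchwarz (R : realType) (I : finType) (P : pred I) (x y : I -> R) :
  (\sum_(i | P i) x i * y i) ^+ 2 <=
  (\sum_(i | P i) x i ^+ 2) * (\sum_(i | P i) y i ^+ 2).
Proof.
set a := \sum_(i | P i) x i ^+ 2; set b := \sum_(i | P i) y i ^+ 2.
set c := \sum_(i | P i) x i * y i.
have a0 : 0 <= a by apply: sumr_ge0 => i _; exact: sqr_ge0.
have [a_eq0|a_neq0] := eqVneq a 0.
  rewrite (_ : c = 0) ?expr0n/= ?a_eq0 ?mul0r//; rewrite /c big1// => i Pi.
  have /eqP := a_eq0; rewrite psumr_eq0 => [|j _]; last exact: sqr_ge0.
  by move=> /allP/(_ i (mem_index_enum i)); rewrite Pi/= sqrf_eq0 => /eqP ->; rewrite mul0r.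
have a_gt0 : 0 < a by rewrite lt_neqAle eq_sym a_neq0.
(* The sum equals [a * (a * b - c ^+ 2)], and [a > 0]. *)
have : 0 <= \sum_(i | P i) (a * y i - c * x i) ^+ 2.
  by apply: sumr_ge0 => i _; exact: sqr_ge0.
rewrite (eq_bigr (fun i => a ^+ 2 * y i ^+ 2 + (- 2 * a * c) * (x i * y i) +
  c ^+ 2 * x i ^+ 2)); last by move=> i _; ring.
rewrite !big_split/= -!mulr_sumr -/a -/b -/c => h.
rewrite -subr_ge0 -(pmulr_rge0 _ a_gt0); apply: le_trans h _; lra.
Qed.

Definition fdot (R : realType) (m n : nat) (A B : 'M[R]_(m, n)) : R :=
  \tr (A^T *m B).

Definition nsq (R : realType) (m n : nat) (A : 'M[R]_(m, n)) : R := fdot A A.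

Lemma fdotE (R : realType) (m n : nat) (A B : 'M[R]_(m, n)) :
  fdot A B = \sum_i \sum_j A i j * B i j.
Proof.
rewrite /fdot /mxtrace exchange_big/=; apply: eq_bigr => j _.
by rewrite !mxE; apply: eq_bigr => i _; rewrite !mxE.
Qed.

Lemma nsqE (R : realType) (m n : nat) (A : 'M[R]_(m, n)) :
  nsq A = \sum_i \sum_j A i j ^+ 2.
Proof. by rewrite /nsq fdotE. Qed.

Lemma nsq_ge0 (R : realType) (m n : nat) (A : 'M[R]_(m, n)) : 0 <= nsq A.
Proof.
by rewrite nsqE; apply: sumr_ge0 => i _; apply: sumr_ge0 => j _; exact: sqr_ge0.
Qed.

Lemma nsq_eq0 (R : realType) (m n : nat) (A : 'M[R]_(m, n)) :
  nsq A = 0 -> A = 0.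
Proof.
rewrite nsqE => /eqP; rewrite psumr_eq0 => [/allP h|i _]; last first.
  by apply: sumr_ge0 => j _; exact: sqr_ge0.
apply/matrixP => i j; rewrite mxE; have := h i (mem_index_enum i).
rewrite /= psumr_eq0 => [/allP/(_ j (mem_index_enum j))|k _]; last exact: sqr_ge0.
by rewrite /= sqrf_eq0 => /eqP.
Qed.

Lemma frobenius_normE (R : realType) (m n : nat) (A : 'M[R]_(m, n)) :
  frobenius_norm A = Num.sqrt (nsq A).
Proof. by rewrite nsqE. Qed.

Lemma fdotC (R : realType) (m n : nat) (A B : 'M[R]_(m, n)) :
  fdot A B = fdot B A.
Proof. by rewrite /fdot -mxtrace_tr trmx_mul trmxK. Qed.

Lemma fdotDl (R : realType) (m n : nat) (A B C : 'M[R]_(m, n)) :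
  fdot (A + B) C = fdot A C + fdot B C.
Proof. by rewrite /fdot linearD/= mulmxDl mxtraceD. Qed.

Lemma fdotDr (R : realType) (m n : nat) (A B C : 'M[R]_(m, n)) :
  fdot C (A + B) = fdot C A + fdot C B.
Proof. by rewrite /fdot mulmxDr mxtraceD. Qed.

Lemma fdotNr (R : realType) (m n : nat) (A B : 'M[R]_(m, n)) :
  fdot A (- B) = - fdot A B.
Proof. by rewrite /fdot mulmxN raddfN. Qed.

Lemma fdotZr (R : realType) (m n : nat) (a : R) (A B : 'M[R]_(m, n)) :
  fdot A (a *: B) = a * fdot A B.
Proof. by rewrite /fdot -scalemxAr mxtraceZ. Qed.

Lemma nsqN (R : realType) (m n : nat) (A : 'M[R]_(m, n)) : nsq (- A) = nsq A.
Proof. by rewrite /nsq fdotNr fdotC fdotNr opprK. Qed.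

Lemma nsqZ (R : realType) (m n : nat) (a : R) (A : 'M[R]_(m, n)) :
  nsq (a *: A) = a ^+ 2 * nsq A.
Proof. by rewrite /nsq fdotZr fdotC fdotZr mulrA. Qed.

Lemma nsqD (R : realType) (m n : nat) (A B : 'M[R]_(m, n)) :
  nsq (A + B) = nsq A + 2 * fdot A B + nsq B.
Proof. by rewrite /nsq fdotDl !fdotDr (fdotC B A); ring. Qed.

Lemma nsq_tr (R : realType) (m n : nat) (A : 'M[R]_(m, n)) : nsq A^T = nsq A.
Proof. by rewrite /nsq /fdot trmxK mxtrace_mulC. Qed.

Lemma fdot_mull (R : realType) (m n r : nat) (P : 'M[R]_(m, r))
    (X : 'M[R]_(m, n)) (Y : 'M[R]_(r, n)) :
  fdot X (P *m Y) = fdot (P^T *m X) Y.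
Proof. by rewrite /fdot trmx_mul trmxK mulmxA. Qed.

Lemma fdot_mulr (R : realType) (m n r : nat) (P : 'M[R]_(r, n))
    (X : 'M[R]_(m, n)) (Y : 'M[R]_(m, r)) :
  fdot X (Y *m P) = fdot (X *m P^T) Y.
Proof. by rewrite /fdot trmx_mul trmxK mulmxA mxtrace_mulC mulmxA. Qed.

Lemma nsq_mull (R : realType) (m n r : nat) (Q : 'M[R]_(m, r))
    (X : 'M[R]_(r, n)) : orthonormal_cols Q -> nsq (Q *m X) = nsq X.
Proof. by move=> hQ; rewrite /nsq fdot_mull mulmxA hQ mul1mx. Qed.

Lemma nsq_mulr (R : realType) (m n r : nat) (Q : 'M[R]_(n, r))
    (X : 'M[R]_(m, r)) : orthonormal_cols Q -> nsq (X *m Q^T) = nsq X.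
Proof. by move=> hQ; rewrite /nsq fdot_mulr trmxK -mulmxA hQ mulmx1. Qed.

Lemma nsq_col (R : realType) (m n : nat) (X : 'M[R]_(m, n)) :
  nsq X = \sum_j nsq (col j X).
Proof.
rewrite nsqE exchange_big/=; apply: eq_bigr => j _; rewrite nsqE.
by apply: eq_bigr => i _; rewrite big_ord1 mxE.
Qed.

Lemma mul_mx_diag_col (R : realType) (m n : nat) (X : 'M[R]_(m, n))
    (d : 'rV[R]_n) (j : 'I_n) :
  col j (X *m diag_mx d) = d 0 j *: col j X.
Proof. by apply/matrixP => a b; rewrite mul_mx_diag !mxE mulrC. Qed.

Lemma fdot_sqr_le (R : realType) (m n : nat) (A B : 'M[R]_(m, n)) :
  fdot A B ^+ 2 <= nsq A * nsq B.
Proof.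
rewrite fdotE !nsqE !pair_big/=.
exact: (sum_CauchySchwarz xpredT (fun p => A p.1 p.2) (fun p => B p.1 p.2)).
Qed.

Lemma mul_mx_col (R : realType) (m n r : nat) (A : 'M[R]_(m, r))
    (B : 'M[R]_(r, n)) (j : 'I_n) : A *m col j B = col j (A *m B).
Proof. by rewrite !colE mulmxA. Qed.

Lemma nsq_col_orthonormal (R : realType) (m n : nat) (Q : 'M[R]_(m, n))
    (j : 'I_n) : orthonormal_cols Q -> nsq (col j Q) = 1.
Proof.
move=> hQ; transitivity ((Q^T *m Q) j j); last by rewrite hQ mxE eqxx.
by rewrite nsqE [RHS]mxE; apply: eq_bigr => i _; rewrite big_ord1 !mxE expr2.
Qed.

Definition is_proj (R : realType) (n : nat) (P : 'M[R]_n) : Prop :=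
  P^T = P /\ P *m P = P.

Lemma is_projC (R : realType) (n : nat) (P : 'M[R]_n) :
  is_proj P -> is_proj (1%:M - P).
Proof.
move=> [PT PP]; split; first by rewrite linearB/= trmx1 PT.
by rewrite mulmxBl mul1mx mulmxBr mulmx1 PP subrr subr0.
Qed.

Lemma is_proj_orthonormal (R : realType) (m n : nat) (Q : 'M[R]_(m, n)) :
  orthonormal_cols Q -> is_proj (Q *m Q^T).
Proof.
move=> hQ; split; first by rewrite trmx_mul trmxK.
by rewrite mulmxA -(mulmxA Q) hQ mulmx1.
Qed.

Lemma nsq_projD (R : realType) (m n : nat) (P : 'M[R]_m) (X : 'M[R]_(m, n)) :
  is_proj P -> nsq X = nsq (P *m X) + nsq ((1%:M - P) *m X).
Proof.
move=> [PT PP].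
have PQ : (1%:M - P)^T *m P = 0.
  by rewrite linearB/= trmx1 PT mulmxBl mul1mx PP subrr.
rewrite -[in LHS](subrK (P *m X) X) addrC.
rewrite -{2}[X]mul1mx -mulmxBl nsqD.
by rewrite fdot_mull mulmxA PQ mul0mx /fdot trmx0 mul0mx mxtrace0 mulr0 addr0.
Qed.

Lemma nsq_proj_le (R : realType) (m n : nat) (P : 'M[R]_m) (X : 'M[R]_(m, n)) :
  is_proj P -> nsq (P *m X) <= nsq X.
Proof. by move=> hP; rewrite (nsq_projD X hP) lerDl nsq_ge0. Qed.

Lemma nsq_proj_ler (R : realType) (m n : nat) (P : 'M[R]_n) (X : 'M[R]_(m, n)) :
  is_proj P -> nsq (X *m P) <= nsq X.
Proof.
move=> hP; rewrite -nsq_tr trmx_mul hP.1 -(nsq_tr X); exact: nsq_proj_le.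
Qed.

(** * Eckart-Young in the Frobenius norm *)

Lemma row_free_gram (R : realType) (r n : nat) (B : 'M[R]_(r, n)) :
  row_free B -> B *m B^T \in unitmx.
Proof.
move=> fB; rewrite -row_free_unit -kermx_eq0; apply/eqP/row_matrixP => i.
rewrite row0; set x := row i _.
have xK : x *m (B *m B^T) = 0.
  by apply/sub_kermxP; rewrite row_sub.
have : nsq (x *m B) = 0.
  by rewrite -nsq_tr /nsq /fdot trmxK trmx_mul !mulmxA -(mulmxA x) xK mul0mx mxtrace0.
move=> /nsq_eq0 xB0; apply: (row_free_inj fB); by rewrite xB0 mul0mx.
Qed.

(** With [C] a row basis of [B], the orthogonal projector onto the row space is [C^T (C C^T)^-1 C].
    The rank of [B] enters Eckart-Young only through this trace. *)
Lemma row_space_proj (R : realType) (m n : nat) (B : 'M[R]_(m, n)) :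
  exists P : 'M[R]_n, [/\ is_proj P, B *m P = B & \tr P = (\rank B)%:R].
Proof.
have [C fC /submxP[D BD]] : exists2 C : 'M[R]_(\rank B, n), row_free C & (B <= C)%MS.
  by exists (row_base B); [exact: row_base_free|rewrite eq_row_base].
set G := C *m C^T.
have uG : G \in unitmx by exact: row_free_gram.
have GT : (invmx G)^T = invmx G.
  by rewrite trmx_inv /G trmx_mul trmxK.
exists (C^T *m invmx G *m C); split.
- split; first by rewrite !trmx_mul !trmxK GT mulmxA.
  rewrite !mulmxA -(mulmxA (C^T *m invmx G) C) -/G.
  by rewrite -(mulmxA C^T (invmx G) G) mulVmx// mulmx1.
- transitivity (D *m C *m (C^T *m invmx G *m C)); first by rewrite -BD.
  by rewrite !mulmxA -(mulmxA D C) -/G -(mulmxA D G) mulmxV// mulmx1 -BD.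
- by rewrite mxtrace_mulC mulmxA -/G mulmxV// mxtrace1.
Qed.

Lemma svd_gram (R : realType) (m n : nat) (A U : 'M[R]_(m, n)) (s : n.-tuple R)
    (V : 'M[R]_n) : is_svd A U s V ->
  A^T *m A = V *m diag_mx (\row_j tnth s j ^+ 2) *m V^T.
Proof.
move=> [hU hV _ _ ->]; rewrite !trmx_mul trmxK tr_diag_mx !mulmxA.
rewrite -(mulmxA _ U^T) hU mulmx1; congr (_ *m _).
rewrite -mulmxA mulmx_diag; congr (_ *m diag_mx _).
by apply/matrixP => i j; rewrite !mxE expr2.
Qed.

Lemma sorted_tnth (R : realType) (n : nat) (s : n.-tuple R) (i j : 'I_n) :
  sorted (fun x y : R => y <= x) s -> (i <= j)%N -> tnth s j <= tnth s i.
Proof.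
move=> ss ij; rewrite !(tnth_nth 0).
have := sorted_leq_nth (leT := fun x y : R => y <= x) _ _ 0 ss.
apply => //; rewrite ?inE ?size_tuple//.
by move=> a b c ab bc; exact: le_trans bc ab.
Qed.

(** A linear program: weights in [[0, 1]] of total at most [r] remove the most from the sum when
    they sit on the [r] largest values. *)
Lemma sum_diag_proj_ge (R : realType) (n r : nat) (s w : 'I_n -> R) :
  (forall i, 0 <= s i) -> (forall i j : 'I_n, (i <= j)%N -> s j <= s i) ->
  (forall i, 0 <= w i <= 1) -> \sum_i w i <= r%:R ->
  \sum_(i < n | (r <= i)%N) s i <= \sum_i s i * (1 - w i).
Proof.
move=> s0 sle w01 wr; have [rn|nr] := ltnP r n; last first.
  rewrite big_pred0 => [|i]; last by apply/negbTE; rewrite -ltnNge (leq_trans (ltn_ord i)).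
  by apply: sumr_ge0 => i _; rewrite mulr_ge0// subr_ge0; case/andP: (w01 i).
set t := s (Ordinal rn); rewrite big_mkcond/= -subr_ge0 -sumrB.
(* Termwise comparison with the threshold value [t]: indices before [r] have [s i >= t], the others
   [s i <= t]. The comparison sum is nonnegative because the weights add up to at most [r]. *)
apply: (@le_trans _ _ (\sum_(i < n) t * ((i < r)%N%:R - w i))).
  rewrite -mulr_sumr; apply: mulr_ge0; first exact: s0.
  rewrite sumrB subr_ge0; apply: le_trans wr _.
  rewrite -natr_sum ler_nat (eq_bigr (fun i : 'I_n => if (i < r)%N then 1%N else 0%N)); last first.
    by move=> i _; case: ifP.
  rewrite -big_mkcond/=.
  rewrite -(big_ord_widen n (fun _ => 1%N) (ltnW rn)).
  by rewrite sum1_card card_ord.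
apply: ler_sum => i _; case: (ltnP i r) => ir.
  rewrite subr0 ler_wpM2r// ?subr_ge0; first by case/andP: (w01 i).
  exact: (sle i (Ordinal rn) (ltnW ir)).
have := sle (Ordinal rn) i ir; rewrite -/t; case/andP: (w01 i) => w0 _ st.
have -> : s i * (1 - w i) - s i = - (s i * w i) by ring.
rewrite sub0r mulrN lerN2.
by rewrite ler_wpM2r.
Qed.

(** Multiplying by [1 - P], with [P] the projector onto the row space of [B], does not increase the
    norm and removes [B]. In the basis [V] the remaining [|A (1 - P)|^2] is a weighted sum of the
    squared singular values, the weights [W j j] being the diagonal of a projector of trace
    [\rank B]. *)
Lemma eckart_young (R : realType) (m n r : nat) (A U : 'M[R]_(m, n))
    (s : n.-tuple R) (V : 'M[R]_n) (B : 'M[R]_(m, n)) :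
  is_svd A U s V -> (\rank B <= r)%N ->
  \sum_(j < n | (r <= j)%N) tnth s j ^+ 2 <= nsq (A - B).
Proof.
move=> svdA rB; have [P [hP BP trP]] := row_space_proj B.
have hP' := is_projC hP.
apply: le_trans (nsq_proj_ler (A - B) hP').
have -> : (A - B) *m (1%:M - P) = A *m (1%:M - P).
  by rewrite mulmxBl !mulmxBr !mulmx1 BP subrr subr0.
have [hU hV ss s0 AE] := svdA.
have VV : V *m V^T = 1%:M by apply: mulmx1C; exact: hV.
pose W := V^T *m P *m V.
have Wij j : W j j = nsq (P *m col j V).
  rewrite /nsq fdot_mull mulmxA hP.1 hP.2 fdotC fdotE /W -mulmxA mxE.
  by apply: eq_bigr => i _; rewrite big_ord1 mul_mx_col !mxE.
have -> : nsq (A *m (1%:M - P)) = \sum_j tnth s j ^+ 2 * (1 - W j j).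
  rewrite /nsq fdot_mulr hP'.1 -mulmxA hP'.2 /fdot trmx_mul hP'.1 -mulmxA.
  rewrite (svd_gram svdA) mxtrace_mulC -!mulmxA mxtrace_mulC -!mulmxA.
  have -> : V^T *m ((1%:M - P) *m V) = 1%:M - W.
    by rewrite mulmxBl mul1mx mulmxBr hV /W mulmxA.
  rewrite mul_diag_mx /mxtrace; apply: eq_bigr => j _.
  rewrite [LHS]mxE [(\row__ _) _ _]mxE; congr (_ * _).
  by rewrite [LHS]mxE [1%:M _ _]mxE eqxx [(- W) _ _]mxE.
apply: sum_diag_proj_ge.
- by move=> i; exact: sqr_ge0.
- by move=> i j ij; rewrite lerXn2r ?nnegrE// sorted_tnth.
- move=> i; rewrite Wij nsq_ge0/=; apply: le_trans (nsq_proj_le _ hP) _.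
  by rewrite nsq_col_orthonormal.
- rewrite -[X in X <= _]/(\tr W) /W mxtrace_mulC mulmxA VV mul1mx trP ler_nat.
  exact: rB.
Qed.

(** * Truncated SVD, its tail, and compression by projectors *)

Definition trunc_row (R : realType) (n k : nat) (s : n.-tuple R) : 'rV[R]_n :=
  \row_j (if (j < k)%N then tnth s j else 0).

Definition tail_row (R : realType) (n k : nat) (s : n.-tuple R) : 'rV[R]_n :=
  \row_j (if (j < k)%N then 0 else tnth s j).

Lemma svd_truncE (R : realType) (m n k : nat) (U : 'M[R]_(m, n))
    (s : n.-tuple R) (V : 'M[R]_n) :
  svd_trunc k U s V = U *m diag_mx (trunc_row k s) *m V^T.
Proof.
apply/matrixP => a b; rewrite /svd_trunc summxE [RHS]mxE [LHS]big_mkcond/=.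
apply: eq_bigr => j _; rewrite mul_mx_diag !mxE.
case: ifP => _; last by rewrite mulr0 mul0r.
by rewrite big_ord1 !mxE; ring.
Qed.

Lemma svd_tailE (R : realType) (m n k : nat) (A U : 'M[R]_(m, n))
    (s : n.-tuple R) (V : 'M[R]_n) : is_svd A U s V ->
  A - svd_trunc k U s V = U *m diag_mx (tail_row k s) *m V^T.
Proof.
move=> [_ _ _ _ AE]; rewrite svd_truncE [in LHS]AE -mulmxBl -mulmxBr -raddfB.
congr (_ *m diag_mx _ *m _); apply/matrixP => i j; rewrite !mxE.
by case: ifP => _; rewrite ?subrr ?subr0.
Qed.

Lemma rank_svd_trunc (R : realType) (m n k : nat) (U : 'M[R]_(m, n))
    (s : n.-tuple R) (V : 'M[R]_n) : (\rank (svd_trunc k U s V) <= k)%N.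
Proof.
apply: (@leq_trans (\sum_(j < n | (j < k)%N) 1)%N); last first.
  rewrite sum1_card -[leqRHS]card_ord.
  case: (leqP k n) => kn; last by rewrite !card_ord (leq_trans (max_card _))// card_ord ltnW.
  by rewrite -sum1_card -(big_ord_widen n (fun _ => 1%N) kn) sum1_card.
rewrite /svd_trunc; elim/big_rec2: _ => [|j a b jk IH]; first by rewrite mxrank0.
apply: leq_trans (mxrank_add _ _) _; apply: leq_add => //.
apply: leq_trans (mxrank_scale _ _) _.
exact: leq_trans (mxrankM_maxl _ _) (rank_leq_col _).
Qed.

Lemma nsq_mul_diag (R : realType) (m n : nat) (X : 'M[R]_(m, n)) (d : 'rV[R]_n) :
  nsq (X *m diag_mx d) = \sum_j d 0 j ^+ 2 * nsq (col j X).
Proof. by rewrite nsq_col; apply: eq_bigr => j _; rewrite mul_mx_diag_col nsqZ. Qed.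

Lemma nsq_svd_tail (R : realType) (m n k : nat) (A U : 'M[R]_(m, n))
    (s : n.-tuple R) (V : 'M[R]_n) : is_svd A U s V ->
  nsq (A - svd_trunc k U s V) = \sum_(j < n | (k <= j)%N) tnth s j ^+ 2.
Proof.
move=> svdA; have [hU hV _ _ _] := svdA.
rewrite (svd_tailE _ svdA) nsq_mulr// nsq_mul_diag [RHS]big_mkcond/=.
apply: eq_bigr => j _; rewrite nsq_col_orthonormal// mulr1 !mxE.
by case: (ltnP j k) => _; rewrite ?expr0n.
Qed.

(** Expand both squares: the cross term of [A] with [Q1 Y Q2^T] is that of the core [Q1^T A Q2] with
    [Y]. Thus [Y] affects the error only through its distance to the core, and Eckart-Young can be
    applied to the core. *)
Lemma nsq_core_sub (R : realType) (m n l : nat) (A : 'M[R]_(m, n))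
    (Q1 : 'M[R]_(m, l)) (Q2 : 'M[R]_(n, l)) (Y : 'M[R]_l) :
  orthonormal_cols Q1 -> orthonormal_cols Q2 ->
  nsq (A - Q1 *m Y *m Q2^T) =
  nsq A - nsq (Q1^T *m A *m Q2) + nsq (Q1^T *m A *m Q2 - Y).
Proof.
move=> h1 h2; rewrite !nsqD !nsqN !fdotNr nsq_mulr// nsq_mull//.
rewrite fdot_mulr trmxK fdot_mull mulmxA; ring.
Qed.

Lemma sor_core_optimal (R : realType) (m n l k : nat) (A : 'M[R]_(m, n))
    (Q1 : 'M[R]_(m, l)) (Q2 : 'M[R]_(n, l)) (U : 'M[R]_l) (s : l.-tuple R)
    (V Y : 'M[R]_l) :
  orthonormal_cols Q1 -> orthonormal_cols Q2 ->
  is_svd (Q1^T *m A *m Q2) U s V -> (\rank Y <= k)%N ->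
  nsq (A - Q1 *m svd_trunc k U s V *m Q2^T) <= nsq (A - Q1 *m Y *m Q2^T).
Proof.
move=> h1 h2 svdM rY; rewrite !nsq_core_sub// lerD2l (nsq_svd_tail _ svdM).
exact: eckart_young svdM rY.
Qed.

Lemma nsq_svd_tail_mul (R : realType) (m n k : nat) (A U : 'M[R]_(m, n))
    (s : n.-tuple R) (V : 'M[R]_n) (kn : (k < n)%N) (y : 'cV[R]_n) :
  is_svd A U s V ->
  nsq ((A - svd_trunc k U s V) *m y) <= tnth s (Ordinal kn) ^+ 2 * nsq y.
Proof.
move=> svdA; have [hU hV ss s0 _] := svdA.
have hVT : orthonormal_cols V^T by rewrite /orthonormal_cols trmxK; exact: mulmx1C.
rewrite (svd_tailE _ svdA) -!mulmxA nsq_mull// -(nsq_mull y hVT) !nsqE mulr_sumr.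
apply: ler_sum => i _; rewrite !big_ord1 mul_diag_mx [in leLHS]mxE exprMn.
apply: ler_wpM2r; first exact: sqr_ge0.
rewrite mxE; case: ltnP => ik; first by rewrite expr0n sqr_ge0.
by rewrite lerXn2r ?nnegrE// sorted_tnth.
Qed.

(* Compressing the truncation [A_k] by two projectors: the only inner product
   that does not vanish is [<A_0, P' A_k Q'>] with [P' = 1 - P], [Q' = 1 - Q],
   and it is at most [e1 * e2] because no singular value of [A_0] exceeds one
   of [A_k]. *)
Lemma nsq_sub_compress (R : realType) (m n k : nat) (A U : 'M[R]_(m, n))
    (s : n.-tuple R) (V : 'M[R]_n) (P : 'M[R]_m) (Q : 'M[R]_n) (e1 e2 : R) :
  is_svd A U s V -> (k < n)%N -> is_proj P -> is_proj Q -> 0 <= e1 -> 0 <= e2 ->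
  \sum_(j < n | (j < k)%N) tnth s j ^+ 2 * nsq ((1%:M - P) *m col j U) <= e1 ^+ 2 ->
  \sum_(j < n | (j < k)%N) tnth s j ^+ 2 * nsq ((1%:M - Q) *m col j V) <= e2 ^+ 2 ->
  nsq (A - P *m svd_trunc k U s V *m Q) <=
  nsq (A - svd_trunc k U s V) + (e1 + e2) ^+ 2.
Proof.
move=> svdA kn hP hQ e10 e20 h1 h2; have [hU hV ss s0 AE] := svdA.
set E := svd_trunc k U s V; set D := A - E.
set P' := 1%:M - P; set Q' := 1%:M - Q.
have hP' : is_proj P' := is_projC hP. have hQ' : is_proj Q' := is_projC hQ.
have EDT : E *m D^T = 0.
  rewrite /D (svd_tailE _ svdA) /E svd_truncE !trmx_mul trmxK tr_diag_mx !mulmxA.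
  rewrite -(mulmxA _ V^T) hV mulmx1 -(mulmxA U) mulmx_diag.
  rewrite (_ : diag_mx _ = 0) ?mulmx0 ?mul0mx//.
  apply/matrixP => i j; rewrite !mxE.
  by case: ifP => _; rewrite ?mulr0 ?mul0r mul0rn.
have DTE : D^T *m E = 0.
  rewrite /D (svd_tailE _ svdA) /E svd_truncE !trmx_mul trmxK tr_diag_mx !mulmxA.
  rewrite -(mulmxA _ U^T) hU mulmx1 -(mulmxA V) mulmx_diag.
  rewrite (_ : diag_mx _ = 0) ?mulmx0 ?mul0mx//.
  apply/matrixP => i j; rewrite !mxE.
  by case: ifP => _; rewrite ?mulr0 ?mul0r mul0rn.
have DPE : fdot D (P' *m E) = 0.
  by rewrite /fdot mulmxA mxtrace_mulC mulmxA EDT mul0mx mxtrace0.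
have DEQ : fdot D (E *m Q') = 0.
  by rewrite /fdot mulmxA DTE mul0mx mxtrace0.
(* Two splittings of the same matrix: this one serves the inner product with [D], where the first
   two terms vanish; [split2] is orthogonal and serves the squared norm, giving [e1^2 + e2^2]. With
   [2 * e1 * e2] from the inner product this is [(e1 + e2)^2]. *)
have split1 : E - P *m E *m Q = P' *m E + E *m Q' - P' *m E *m Q'.
  rewrite /P' /Q' !mulmxBr !mulmxBl !mul1mx !mulmx1.
  by apply/matrixP => i j; rewrite !mxE; ring.
have split2 : E - P *m E *m Q = P' *m E + P *m (E *m Q').
  rewrite /P' /Q' !mulmxBr !mulmxBl !mul1mx !mulmx1 mulmxA.
  by apply/matrixP => i j; rewrite !mxE; ring.
have PE : nsq (P' *m E) <= e1 ^+ 2.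
  rewrite /E svd_truncE mulmxA nsq_mulr// mulmxA nsq_mul_diag.
  apply: le_trans h1; rewrite [leRHS]big_mkcond/=; apply: ler_sum => j _.
  rewrite mul_mx_col mxE; case: ifP => _ //.
  by rewrite expr0n mul0r.
have EQ : nsq (E *m Q') <= e2 ^+ 2.
  rewrite -nsq_tr /E svd_truncE !trmx_mul trmxK tr_diag_mx hQ'.1 mulmxA.
  rewrite mulmxA nsq_mulr// nsq_mul_diag.
  apply: le_trans h2; rewrite [leRHS]big_mkcond/=; apply: ler_sum => j _.
  rewrite mul_mx_col mxE; case: ifP => _ //.
  by rewrite expr0n mul0r.
have cross : - fdot D (P' *m E *m Q') <= e1 * e2.
  pose a (j : 'I_n) := tnth s j * Num.sqrt (nsq (P' *m col j U)).
  pose b (j : 'I_n) := tnth s j * Num.sqrt (nsq (Q' *m col j V)).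
  have ab : - fdot D (P' *m E *m Q') <= \sum_(j < n | (j < k)%N) a j * b j.
    have -> : P' *m E *m Q' = \sum_(j < n | (j < k)%N)
        tnth s j *: (P' *m col j U *m (Q' *m col j V)^T).
      rewrite /E /svd_trunc mulmx_sumr mulmx_suml; apply: eq_bigr => j _.
      by rewrite -scalemxAr -scalemxAl trmx_mul hQ'.1 !mulmxA.
    have -> : fdot D (\sum_(j < n | (j < k)%N)
        tnth s j *: (P' *m col j U *m (Q' *m col j V)^T)) = \sum_(j < n | (j < k)%N)
        tnth s j * fdot (D *m (Q' *m col j V)) (P' *m col j U).
      rewrite /fdot mulmx_sumr raddf_sum/=; apply: eq_bigr => j _.
      rewrite -[LHS]/(fdot D _) fdotZr; congr (_ * _).
      by rewrite fdot_mulr trmxK.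
    rewrite -sumrN; apply: ler_sum => j jk; rewrite /a /b -mulrN.
    set x := P' *m _; set y := Q' *m _.
    have sj := s0 j.
    (* The order of the singular values enters here: [D] stretches [y] by at most the first
       discarded singular value, which is at most [s_j] since [j < k]. *)
    have hle : - fdot (D *m y) x <= tnth s j * (Num.sqrt (nsq x) * Num.sqrt (nsq y)).
      apply: le_trans (ler_norm _) _.
      rewrite -(ler_pXn2r (ltn0Sn 1)) ?nnegrE ?mulr_ge0// normrN real_normK ?num_real//.
      apply: le_trans (fdot_sqr_le _ _) _.
      rewrite !exprMn !sqr_sqrtr ?nsq_ge0// [leRHS]mulrA mulrAC.
      apply: ler_wpM2r; first exact: nsq_ge0.
      apply: le_trans (nsq_svd_tail_mul kn y svdA) _.
      apply: ler_wpM2r; first exact: nsq_ge0.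
      by rewrite lerXn2r ?nnegrE// sorted_tnth// ltnW.
    apply: le_trans (ler_wpM2l sj hle) _; lra.
  apply: le_trans ab _; apply: le_trans (ler_norm _) _.
  rewrite -(ler_pXn2r (ltn0Sn 1)) ?nnegrE ?mulr_ge0// real_normK ?num_real//.
  apply: le_trans (sum_CauchySchwarz _ _ _) _; rewrite exprMn.
  apply: ler_pM.
  - by apply: sumr_ge0 => j _; exact: sqr_ge0.
  - by apply: sumr_ge0 => j _; exact: sqr_ge0.
  - apply: le_trans h1; apply: ler_sum => j _.
    by rewrite exprMn sqr_sqrtr ?nsq_ge0.
  - apply: le_trans h2; apply: ler_sum => j _.
    by rewrite exprMn sqr_sqrtr ?nsq_ge0.
have -> : A - P *m E *m Q = D + (E - P *m E *m Q).
  by rewrite /D addrA subrK.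
rewrite nsqD [in 2 * _]split1 !fdotDr fdotNr DPE DEQ split2 (nsqD (P' *m E)).
have -> : fdot (P' *m E) (P *m (E *m Q')) = 0.
  rewrite fdot_mull mulmxA hP.1 mulmxBr mulmx1 hP.2 subrr mul0mx.
  by rewrite /fdot trmx0 mul0mx mxtrace0.
have := le_trans (nsq_proj_le (E *m Q') hP) EQ.
move: PE cross; lra.
Qed.

(* Reverse Eckart-Young: for a unit vector [x], replacing [B] by
   [B + (A - B) x x^T] raises the rank by at most one and removes
   [(A - B) x] from the error. *)
Lemma nsq_mul_reverse_eckart_young (R : realType) (m n k : nat)
    (A U : 'M[R]_(m, n)) (s : n.-tuple R) (V : 'M[R]_n) (B : 'M[R]_(m, n))
    (x : 'cV[R]_n) (eta : R) (kn : (k < n)%N) :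
  is_svd A U s V -> (\rank B <= k)%N ->
  nsq (A - B) <= nsq (A - svd_trunc k U s V) + eta -> nsq x <= 1 -> 0 <= eta ->
  nsq ((A - B) *m x) <= tnth s (Ordinal kn) ^+ 2 + eta.
Proof.
move=> svdA rB hAB x1 eta0; have [x0|xn0] := eqVneq (nsq x) 0.
  rewrite (nsq_eq0 x0) mulmx0 /nsq /fdot mulmx0 mxtrace0.
  by rewrite addr_ge0// sqr_ge0.
have xgt0 : 0 < nsq x by rewrite lt_neqAle eq_sym xn0 nsq_ge0.
pose M := A - B; pose W := (nsq x)^-1 *: (M *m x *m x^T).
have xx : x^T *m x = (nsq x)%:M.
  by apply/matrixP => i j; rewrite !ord1 [RHS]mxE eqxx mulr1n /nsq /fdot /mxtrace big_ord1.
have nW : nsq W = (nsq x)^-1 * nsq (M *m x).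
  rewrite /W nsqZ /nsq fdot_mulr trmxK -mulmxA xx mul_mx_scalar fdotC fdotZr.
  by rewrite -/(nsq x); field.
have ort : fdot W (M - W) = 0.
  rewrite fdotDr fdotNr -/(nsq W) nW fdotC /W fdotZr fdot_mulr trmxK -/(nsq _).
  by rewrite subrr.
have rW : (\rank (B + W)%R <= k.+1)%N.
  apply: leq_trans (mxrank_add _ _) _; rewrite -addn1 leq_add//.
  rewrite /W; apply: leq_trans (mxrank_scale _ _) _.
  exact: leq_trans (mxrankM_maxr _ _) (rank_leq_row _).
have EY := eckart_young svdA rW.
(* Pythagoras. Eckart-Young at rank [k.+1] bounds the last term below by the tail starting at index
   [k.+1], so only the term of index [k] and [eta] are left for [nsq W]. *)
have MW : nsq M = nsq W + nsq (A - (B + W)).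
  have -> : A - (B + W) = M - W by rewrite opprD addrA.
  by rewrite -[in LHS](subrK W M) (addrC (M - W)) (nsqD W) ort mulr0 addr0.
have S : \sum_(j < n | (k <= j)%N) tnth s j ^+ 2 = tnth s (Ordinal kn) ^+ 2 +
    \sum_(j < n | (k.+1 <= j)%N) tnth s j ^+ 2.
  rewrite (bigD1 (Ordinal kn))/= ?leqnn//; congr (_ + _).
  by apply: eq_bigl => j; rewrite ltn_neqAle andbC -val_eqE/= eq_sym.
rewrite -/M MW (nsq_svd_tail _ svdA) S in hAB.
have hW : nsq W <= tnth s (Ordinal kn) ^+ 2 + eta by lra.
have -> : nsq ((A - B) *m x) = nsq x * nsq W by rewrite nW mulVKf.
apply: le_trans hW; rewrite ler_piMl//; exact: nsq_ge0.
Qed.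

(** * From squared Frobenius errors to both norms *)

Lemma frobenius_le_spectral (R : realType) (m n : nat) (A : 'M[R]_(m, n))
    (x : 'cV[R]_n) : nsq x <= 1 -> Num.sqrt (nsq (A *m x)) <= spectral_norm A.
Proof.
move=> x1; apply: sup_upper_bound; last first.
  exists x; last by rewrite frobenius_normE.
  by rewrite /= frobenius_normE -(sqrtr1 R) ler_wsqrtr.
split; first by exists (frobenius_norm (A *m x)), x => //=;
  rewrite frobenius_normE -(sqrtr1 R) ler_wsqrtr.
(* The supremum is genuine only if the set is bounded: the Frobenius norm of [A] is a bound, by
   Cauchy-Schwarz in each row. *)
exists (Num.sqrt (nsq A)) => _ [y /= y1 <-]; rewrite frobenius_normE ler_wsqrtr//.
have {}y1 : nsq y <= 1.
  by move: y1; rewrite frobenius_normE -[X in _ <= X](sqrtr1 R) ler_sqrt.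
rewrite !nsqE; apply: ler_sum => i _; rewrite big_ord1 mxE.
apply: le_trans (sum_CauchySchwarz _ _ _) _.
rewrite ler_piMr//; first by apply: sumr_ge0 => j _; exact: sqr_ge0.
by move: y1; rewrite nsqE; under eq_bigr do rewrite big_ord1.
Qed.

Lemma spectral_norm_le (R : realType) (m n : nat) (A : 'M[R]_(m, n)) (c : R) :
  (forall x : 'cV[R]_n, nsq x <= 1 -> nsq (A *m x) <= c ^+ 2) -> 0 <= c ->
  spectral_norm A <= c.
Proof.
move=> h c0; apply: ge_sup.
  exists (frobenius_norm (A *m (0 : 'cV[R]_n))), 0 => //=.
  by rewrite frobenius_normE /nsq /fdot mulmx0 mxtrace0 sqrtr0.
move=> _ [y /= y1 <-]; rewrite frobenius_normE -(ger0_norm c0) -sqrtr_sqr.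
apply: ler_wsqrtr; apply: h.
by move: y1; rewrite frobenius_normE -[X in _ <= X](sqrtr1 R) ler_sqrt.
Qed.

(** Both cases end with [a^2 + b^2 <= (a + b)^2] for nonnegative [a] and [b]. For the spectral norm,
    [a] is the singular value of 0-based index [k], which the norm of [A_0] dominates, as testing on
    the corresponding right singular vector shows. *)
Lemma mxnorm_error_le (R : realType) (m n k : nat) (A U : 'M[R]_(m, n))
    (s : n.-tuple R) (V : 'M[R]_n) (B : 'M[R]_(m, n)) (eta : R)
    (rho : norm_kind) :
  is_svd A U s V -> (k < n)%N -> (\rank B <= k)%N -> 0 <= eta ->
  nsq (A - B) <= nsq (A - svd_trunc k U s V) + eta ^+ 2 ->
  mxnorm rho (A - B) <= mxnorm rho (A - svd_trunc k U s V) + eta.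
Proof.
move=> svdA kn rB eta0 h; have [hU hV _ s0 _] := svdA.
have add_sqr (a b : R) : 0 <= a -> 0 <= b -> a ^+ 2 + b ^+ 2 <= (a + b) ^+ 2.
  by move=> a0 b0; nra.
case: rho => /=.
- have tE : tnth s (Ordinal kn) <= spectral_norm (A - svd_trunc k U s V).
    have x1 : nsq (col (Ordinal kn) V) = 1 by rewrite nsq_col_orthonormal.
    apply: le_trans (@frobenius_le_spectral _ _ _ _ (col (Ordinal kn) V) _); last first.
      by rewrite x1.
    rewrite (svd_tailE _ svdA) -mulmxA mul_mx_col hV -mulmxA.
    rewrite (_ : diag_mx _ *m _ = tnth s (Ordinal kn) *: col (Ordinal kn) 1%:M).
      rewrite -scalemxAr mul_mx_col mulmx1 nsqZ nsq_col_orthonormal// mulr1.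
      by rewrite sqrtr_sqr ger0_norm.
    rewrite mul_mx_col mulmx1; apply/matrixP => i j; rewrite !mxE.
    by case: eqP => [->|_]; rewrite ?mulr0 ?mulr0n//= ltnn mulr1.
  apply: le_trans (lerD tE (lexx eta)).
  apply: spectral_norm_le; last by rewrite addr_ge0.
  move=> x x1.
  apply: le_trans (nsq_mul_reverse_eckart_young kn svdA rB h x1 (sqr_ge0 eta)) _.
  exact: add_sqr.
- rewrite !frobenius_normE.
  set a := nsq (A - svd_trunc _ _ _ _) in h *.
  have a0 : 0 <= a by exact: nsq_ge0.
  rewrite -(@ger0_norm _ (Num.sqrt a + eta)) ?addr_ge0// -sqrtr_sqr.
  apply: ler_wsqrtr; apply: le_trans h _.
  by rewrite -{1}(sqr_sqrtr a0) add_sqr.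
Qed.

(* [P] kills [T w = s_j^(r+1) u_j + (a combination of the u_i with i >= N)]. *)
Lemma range_residual_le (R : realType) (m n l N r : nat) (U : 'M[R]_(m, n))
    (s : n.-tuple R) (G : 'M[R]_(n, l)) (P : 'M[R]_m) (w : 'cV[R]_l)
    (j : 'I_n) (sig sk : R) :
  orthonormal_cols U -> is_proj P ->
  P *m (U *m diag_mx (\row_i tnth s i ^+ r.+1) *m G) = 0 ->
  (forall i : 'I_n, 0 <= tnth s i) ->
  (forall i : 'I_n, (N <= i)%N -> tnth s i <= sig) ->
  (j < N)%N -> 0 < sk <= tnth s j -> 0 <= sig ->
  (forall i : 'I_n, (i < N)%N -> (G *m w) i 0 = (i == j)%:R) ->
  tnth s j ^+ 2 * nsq (P *m col j U) <=
  (sig * (sig / sk) ^+ r) ^+ 2 * \sum_(i < n | (N <= i)%N) (G *m w) i 0 ^+ 2.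
Proof.
move=> hU hP PT s0 ssig jN /andP[sk0 skj] sig0 Gw.
have sj0 : 0 < tnth s j := lt_le_trans sk0 skj.
set Z := \sum_(i < n | _) _.
have Z0 : 0 <= Z by apply: sumr_ge0 => i _; exact: sqr_ge0.
pose y : 'cV[R]_n := \col_i (if (N <= i)%N then tnth s i ^+ r.+1 * (G *m w) i 0 else 0).
have Tw : U *m diag_mx (\row_i tnth s i ^+ r.+1) *m G *m w =
    tnth s j ^+ r.+1 *: col j U + U *m y.
  rewrite colE scalemxAr -mulmxDr -!mulmxA; congr (_ *m _).
  apply/matrixP => i a; rewrite !ord1 mul_diag_mx.
  rewrite [LHS]mxE [(\row__ _) _ _]mxE [RHS]mxE [y _ _]mxE [X in _ = X + _]mxE.
  rewrite [delta_mx _ _ _ _]mxE eqxx andbT.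
  case: leqP => iN; last first.
    by rewrite Gw// addr0; case: eqP => [->|]; rewrite ?mulr0.
  by rewrite (_ : (i == j) = false) ?mulr0 ?add0r//; apply/eqP => ij; rewrite ij leqNgt jN in iN.
have eqn : tnth s j ^+ r.+1 *: (P *m col j U) = - (P *m (U *m y)).
  apply/eqP; rewrite -subr_eq0 opprK scalemxAr -mulmxDr -Tw !mulmxA.
  by move: PT; rewrite !mulmxA => ->; rewrite mul0mx.
have ub : tnth s j ^+ r.+1 ^+ 2 * nsq (P *m col j U) <= sig ^+ r.+1 ^+ 2 * Z.
  rewrite -nsqZ eqn nsqN; apply: le_trans (nsq_proj_le _ hP) _.
  rewrite nsq_mull// nsqE /Z mulr_sumr [leRHS]big_mkcond/=.
  apply: ler_sum => i _; rewrite big_ord1 mxE; case: ifPn => iN; last by rewrite expr0n.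
  rewrite exprMn ler_wpM2r ?sqr_ge0// lerXn2r ?nnegrE ?exprn_ge0//.
  by rewrite lerXn2r ?nnegrE// ssig.
have sjr : 0 < tnth s j ^+ r ^+ 2 by rewrite !exprn_gt0.
(* Multiply through by [s_j^(2r)] in order to use [ub]. What remains follows from
   [sig <= s_j * (sig / sk)], that is, from [sk <= s_j]. *)
rewrite -(ler_pM2l sjr).
have -> : tnth s j ^+ r ^+ 2 * (tnth s j ^+ 2 * nsq (P *m col j U)) =
  tnth s j ^+ r.+1 ^+ 2 * nsq (P *m col j U) by rewrite (exprS _ r); ring.
apply: le_trans ub _; rewrite mulrA; apply: ler_wpM2r => //.
rewrite -exprMn lerXn2r ?nnegrE ?mulr_ge0 ?exprn_ge0 ?divr_ge0// ?(ltW sk0)//.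
rewrite (exprS _ r) mulrCA; apply: ler_wpM2l => //.
have q0 : 0 <= sig / sk by rewrite divr_ge0// ltW.
rewrite -exprMn; apply: lerXn2r; rewrite ?nnegrE ?(mulr_ge0 (ltW sj0) q0)//.
by rewrite mulrCA ler_peMr// ler_pdivlMr// mul1r.
Qed.

(** * The error of one run *)

Lemma svd_power_range (R : realType) (m n q : nat) (A U : 'M[R]_(m, n))
    (s : n.-tuple R) (V : 'M[R]_n) : is_svd A U s V ->
  (A *m A^T) ^+ q *m A = U *m diag_mx (\row_i tnth s i ^+ (2 * q).+1) *m V^T.
Proof.
move=> svdA; have [hU hV _ _ AE] := svdA.
elim: q => [|q IH].
  by rewrite expr0 mul1mx muln0 [LHS]AE.
rewrite exprS -mulmxE -mulmxA IH -mulmxA.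
have -> : A^T *m (U *m diag_mx (\row_i tnth s i ^+ (2 * q).+1) *m V^T) =
    V *m diag_mx (\row_i tnth s i ^+ (2 * q).+2) *m V^T.
  rewrite AE !trmx_mul trmxK tr_diag_mx !mulmxA -(mulmxA _ U^T U) hU mulmx1.
  congr (_ *m _); rewrite -mulmxA mulmx_diag; congr (_ *m diag_mx _).
  by apply/matrixP => i j; rewrite !mxE -exprS.
rewrite [in LHS]AE !mulmxA -(mulmxA _ V^T V) hV mulmx1.
congr (_ *m _); rewrite -mulmxA mulmx_diag; congr (_ *m diag_mx _).
by apply/matrixP => i j; rewrite !mxE -exprS mulnS.
Qed.

Lemma qr_residual (R : realType) (m l : nat) (T Q : 'M[R]_(m, l)) (S : 'M[R]_l) :
  is_qr T Q S -> (1%:M - Q *m Q^T) *m T = 0.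
Proof.
move=> [hQ _ ->]; rewrite mulmxBl mul1mx mulmxA -(mulmxA Q) hQ mulmx1.
by rewrite subrr.
Qed.

Lemma sor_svd_power0 (R : realType) (m n l k : nat) (A : 'M[R]_(m, n))
    (Omega : 'M[R]_(n, l)) (Ahat : 'M[R]_(m, n)) :
  sor_svd k A Omega Ahat -> sor_svd_power k 0 A Omega Ahat.
Proof. by rewrite /sor_svd_power expr0 mul1mx. Qed.

Lemma singval_tnth (R : realType) (n : nat) (s : n.-tuple R) (j : nat)
    (jn : (j.-1 < n)%N) : singval s j = tnth s (Ordinal jn).
Proof. by rewrite (tnth_nth 0). Qed.

Lemma sor_svd_power_error (R : realType) (m n l k N q : nat)
    (A U : 'M[R]_(m, n)) (s : n.-tuple R) (V : 'M[R]_n) (Omega : 'M[R]_(n, l))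
    (Ahat : 'M[R]_(m, n)) (w : 'I_n -> 'cV[R]_l) (rho : norm_kind)
    (sigma gamma : R) :
  is_svd A U s V -> (1 <= k <= N)%N -> (N < n)%N -> 0 < singval s k ->
  sor_svd_power k q A Omega Ahat ->
  (forall i j : 'I_n, (j < k)%N -> (i < N)%N ->
     (V^T *m Omega *m w j) i 0 = (i == j)%:R) ->
  sigma = singval s N.+1 -> gamma = sigma / singval s k ->
  mxnorm rho (A - Ahat) <= mxnorm rho (A - svd_trunc k U s V) +
    (1 + gamma) * sigma * gamma ^+ (2 * q) *
    Num.sqrt (\sum_(j < n | (j < k)%N) \sum_(i < n | (N <= i)%N)
                (V^T *m Omega *m w j) i 0 ^+ 2).
Proof.
move=> svdA /andP[k1 kN] Nn sk0 [Q1 [S1 [Q2 [S2 [Um [sm [Vm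
  [qr1 qr2 svdM AhatE]]]]]]]] hw sigmaE gammaE.
have [hU hV ss s0 AE] := svdA.
have kn : (k < n)%N := leq_ltn_trans kN Nn.
have k1n : (k.-1 < n)%N by rewrite prednK// ltnW.
set Z2 := \sum_(j < n | _) _.
have Z20 : 0 <= Z2.
  by apply: sumr_ge0 => j _; apply: sumr_ge0 => i _; exact: sqr_ge0.
have [hQ1 _ _] := qr1; have [hQ2 _ _] := qr2.
have sig0 : 0 <= sigma by rewrite sigmaE (@singval_tnth _ _ s N.+1 Nn).
have gam0 : 0 <= gamma by rewrite gammaE divr_ge0// ltW.
have ssig (i : 'I_n) : (N <= i)%N -> tnth s i <= sigma.
  by move=> Ni; rewrite sigmaE (@singval_tnth _ _ s N.+1 Nn) sorted_tnth.
have skj (j : 'I_n) : (j < k)%N -> 0 < singval s k <= tnth s j.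
  move=> jk; rewrite sk0 (@singval_tnth _ _ s k k1n) sorted_tnth//=.
  by rewrite -ltnS prednK.
have T1E := svd_power_range q svdA.
have P1T : (1%:M - Q1 *m Q1^T) *m
    (U *m diag_mx (\row_i tnth s i ^+ (2 * q).+1) *m (V^T *m Omega)) = 0.
  by rewrite [in X in _ *m X]mulmxA -T1E (qr_residual qr1).
have P2T : (1%:M - Q2 *m Q2^T) *m
    (V *m diag_mx (\row_i tnth s i ^+ (2 * q).+2) *m (V^T *m Omega)) = 0.
  rewrite -[RHS](qr_residual qr2) T1E; congr (_ *m _).
  rewrite {1}AE !trmx_mul trmxK tr_diag_mx !mulmxA -(mulmxA _ U^T U) hU mulmx1.
  do 2 congr (_ *m _); rewrite -mulmxA mulmx_diag; congr (_ *m diag_mx _).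
  by apply/matrixP => i j; rewrite !mxE -exprS.
(* A range built with the singular values to the power [r + 1] leaves a residual of at most [e r].
   Here [r = 2q] for [T1] and [r = 2q + 1] for [T2], and the two add up to the factor
   [1 + gamma]. *)
pose e r := sigma * gamma ^+ r * Num.sqrt Z2.
have e0 r : 0 <= e r by rewrite !mulr_ge0 ?exprn_ge0.
have eE r : e r ^+ 2 = \sum_(j < n | (j < k)%N) (sigma * gamma ^+ r) ^+ 2 *
    \sum_(i < n | (N <= i)%N) (V^T *m Omega *m w j) i 0 ^+ 2.
  by rewrite -mulr_sumr -/Z2 exprMn sqr_sqrtr.
have resid (a r : nat) (X : 'M[R]_(a, n)) (P : 'M[R]_a) :
    orthonormal_cols X -> is_proj P ->
    P *m (X *m diag_mx (\row_i tnth s i ^+ r.+1) *m (V^T *m Omega)) = 0 ->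
    \sum_(j < n | (j < k)%N) tnth s j ^+ 2 * nsq (P *m col j X) <= e r ^+ 2.
  move=> hX hP PX; rewrite eE; apply: ler_sum => j jk.
  rewrite gammaE; apply: (range_residual_le hX hP PX) => //.
  - exact: leq_trans kN.
  - exact: skj.
  - by move=> i iN; exact: hw.
have hP1 := is_proj_orthonormal hQ1; have hP2 := is_proj_orthonormal hQ2.
have main := nsq_sub_compress svdA kn hP1 hP2 (e0 _) (e0 _)
  (resid _ _ _ _ hU (is_projC hP1) P1T) (resid _ _ _ _ hV (is_projC hP2) P2T).
have -> : (1 + gamma) * sigma * gamma ^+ (2 * q) * Num.sqrt Z2 =
    e (2 * q)%N + e (2 * q).+1 by rewrite /e exprS; ring.
apply: mxnorm_error_le => //.
- rewrite AhatE; apply: leq_trans (mxrankM_maxl _ _) _.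
  by apply: leq_trans (mxrankM_maxr _ _) _; exact: rank_svd_trunc.
- by rewrite addr_ge0.
- apply: le_trans main; rewrite AhatE.
  have -> : Q1 *m Q1^T *m svd_trunc k U s V *m (Q2 *m Q2^T) =
      Q1 *m (Q1^T *m svd_trunc k U s V *m Q2) *m Q2^T by rewrite !mulmxA.
  apply: (sor_core_optimal hQ1 hQ2 svdM).
  apply: leq_trans (mxrankM_maxl _ _) _.
  by apply: leq_trans (mxrankM_maxr _ _) _; exact: rank_svd_trunc.
Qed.

(** * Givens rotations *)

Definition givens (R : realType) (n : nat) (a b : 'I_n) (c s : R) : 'M[R]_n :=
  \matrix_(i, j) (if i == a then c * (j == a)%:R - s * (j == b)%:R
                  else if i == b then s * (j == a)%:R + c * (j == b)%:R
                  else (i == j)%:R).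

(* The restriction [0 <= c] excludes the rotation by a half turn, which is not
   a product of three shears of the plane. *)
Inductive givens_prod (R : realType) (n : nat) : 'M[R]_n -> Prop :=
| givens_prod1 : givens_prod 1%:M
| givens_prodM a b c s O : a != b -> 0 <= c -> c ^+ 2 + s ^+ 2 = 1 ->
    givens_prod O -> givens_prod (givens a b c s *m O).

Lemma givens_mulE (R : realType) (n r : nat) (a b : 'I_n) (c s : R)
    (X : 'M[R]_(n, r)) (i : 'I_n) (j : 'I_r) : a != b ->
  (givens a b c s *m X) i j =
  if i == a then c * X a j - s * X b j
  else if i == b then s * X a j + c * X b j else X i j.
Proof.
move=> ab.
have sumd (e : 'I_n) (x : R) : \sum_k x * (k == e)%:R * X k j = x * X e j.
  rewrite (bigD1 e)//= eqxx mulr1 big1 ?addr0// => k /negbTE ->.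
  by rewrite mulr0 mul0r.
rewrite mxE; case: ifPn => ia.
  under eq_bigr do rewrite mxE ia mulrBl.
  by rewrite sumrB !sumd.
case: ifPn => ib.
  under eq_bigr do rewrite mxE (negbTE ia) ib mulrDl.
  by rewrite big_split/= !sumd.
under eq_bigr do rewrite mxE (negbTE ia) (negbTE ib) -[_%:R]mul1r eq_sym.
by rewrite sumd mul1r.
Qed.

Lemma givens_tr (R : realType) (n : nat) (a b : 'I_n) (c s : R) : a != b ->
  (givens a b c s)^T = givens a b c (- s).
Proof.
move=> ab; have ba : (b == a) = false by rewrite eq_sym (negbTE ab).
apply/matrixP => i j; rewrite !mxE.
have [->|ia] := eqVneq i a; have [->|ja] := eqVneq j a;
  rewrite ?eqxx ?(negbTE ab) ?ba ?(negbTE ia) ?(negbTE ja) ?(eq_sym a i) ?(eq_sym a j);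
  rewrite ?(negbTE ia) ?(negbTE ja);
  have [?|ib] := eqVneq i b; have [?|jb] := eqVneq j b; subst;
  rewrite ?eqxx ?(negbTE ab) ?ba ?(negbTE ib) ?(negbTE jb) ?(eq_sym b i) ?(eq_sym b j)
    ?(negbTE ib) ?(negbTE jb) ?(eq_sym j i) /=; try ring; try done.
Qed.

Lemma givens_orthonormal (R : realType) (n : nat) (a b : 'I_n) (c s : R) :
  a != b -> c ^+ 2 + s ^+ 2 = 1 -> orthonormal_cols (givens a b c s).
Proof.
move=> ab cs; rewrite /orthonormal_cols givens_tr//.
have ba : (b == a) = false by rewrite eq_sym (negbTE ab).
apply/matrixP => i j; rewrite givens_mulE// -[givens a b c s]mulmx1.
rewrite !givens_mulE// !eqxx ba.
have [->|ia] := eqVneq i a; first by rewrite -[RHS]mul1r -cs; ring.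
have [->|ib] := eqVneq i b; first by rewrite -[RHS]mul1r -cs; ring.
by [].
Qed.

Lemma orthonormal_colsM (R : realType) (n : nat) (O1 O2 : 'M[R]_n) :
  orthonormal_cols O1 -> orthonormal_cols O2 -> orthonormal_cols (O1 *m O2).
Proof.
move=> h1 h2; rewrite /orthonormal_cols trmx_mul mulmxA -(mulmxA O2^T) h1.
by rewrite mulmx1.
Qed.

Lemma givens_prod_orthonormal (R : realType) (n : nat) (O : 'M[R]_n) :
  givens_prod O -> orthonormal_cols O.
Proof.
elim=> [|a b c s {}O ab c0 cs _ IH]; first by rewrite /orthonormal_cols trmx1 mulmx1.
by apply: orthonormal_colsM => //; exact: givens_orthonormal.
Qed.

Lemma givens_prod_mul (R : realType) (n : nat) (O1 O2 : 'M[R]_n) :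
  givens_prod O1 -> givens_prod O2 -> givens_prod (O1 *m O2).
Proof.
move=> h1 h2; elim: h1 => [|a b c s O ab c0 cs _ IH]; first by rewrite mul1mx.
by rewrite -mulmxA; exact: givens_prodM.
Qed.

(** The normalized pair [(x, - y)] solves the equation up to a global sign; the sign is spent on
    making [c] nonnegative. *)
Lemma givens_coeff (R : realType) (x y : R) :
  exists c s : R, [/\ 0 <= c, c ^+ 2 + s ^+ 2 = 1 & s * x + c * y = 0].
Proof.
have [xy0|xy0] := eqVneq (x ^+ 2 + y ^+ 2) 0.
  exists 1, 0; split; rewrite ?ler01 ?expr0n ?addr0 ?expr1n// mul0r add0r mul1r.
  apply/eqP; rewrite -sqrf_eq0; move: xy0 (sqr_ge0 x) (sqr_ge0 y) => h1 h2 h3.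
  by apply/eqP; lra.
have r2 : 0 < x ^+ 2 + y ^+ 2 by rewrite lt_neqAle eq_sym xy0 addr_ge0 ?sqr_ge0.
set r := Num.sqrt (x ^+ 2 + y ^+ 2).
have r0 : 0 < r by rewrite sqrtr_gt0.
have rE : r ^+ 2 = x ^+ 2 + y ^+ 2 by rewrite sqr_sqrtr// ltW.
have rn0 : r != 0 by rewrite gt_eqF.
have one : (x ^+ 2 + y ^+ 2) / r ^+ 2 = 1 by rewrite -rE divff// sqrf_eq0.
have [x0|x0] := leP 0 x.
  exists (x / r), (- y / r); split; first by rewrite divr_ge0// ltW.
  - by rewrite -one; field.
  - by field.
exists (- x / r), (y / r); split; first by rewrite divr_ge0 ?ltW// oppr_gt0.
- by rewrite -one; field.
- by field.
Qed.

Lemma givens_triangularize (R : realType) (n m : nat) (H : 'M[R]_(n, m)) :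
  exists2 O : 'M[R]_n, givens_prod O &
    forall (i : 'I_n) (j : 'I_m), (j < i)%N -> (O *m H) i j = 0.
Proof.
(* Progress of the elimination: below the diagonal, the columns before [j] are cleared, and column
   [j] is cleared in the rows before [i]. *)
pose Z (j i : nat) (X : 'M[R]_(n, m)) := forall (a : 'I_n) (b : 'I_m), (b < a)%N ->
  (b < j)%N || ((b == j :> nat) && (a < i)%N) -> X a b = 0.
have step j i : (i < n)%N -> (j < m)%N ->
    forall X, Z j i X -> exists2 O, givens_prod O & Z j i.+1 (O *m X).
  move=> lin ljm X ZX; have [lij|lji] := leqP i j.
    exists 1%:M; first exact: givens_prod1.
    rewrite mul1mx => a b ba /orP[bj|/andP[/eqP bj ai]]; first by apply: ZX => //; rewrite bj.
    by move: (leq_ltn_trans lij (leq_ltn_trans (eq_leq (esym bj)) ba)); rewrite ltnNge -ltnS ai.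
  have ljn : (j < n)%N := ltn_trans lji lin.
  pose oi := Ordinal lin; pose oj := Ordinal ljn; pose cj := Ordinal ljm.
  have [c [s [c0 cs sc]]] := givens_coeff (X oj cj) (X oi cj).
  have ne : oj != oi by rewrite -val_eqE/= ltn_eqF.
  (* Columns before [j] are below the diagonal in both rows [j] and [i], hence already zero there,
     and mixing the two rows keeps these zeros. *)
  exists (givens oj oi c s).
    by rewrite -[givens _ _ _ _]mulmx1; apply: givens_prodM => //; exact: givens_prod1.
  move=> a b ba h; rewrite givens_mulE//.
  case: ifPn => [/eqP aj|naj].
    have bj : (b < j)%N by move: ba; rewrite aj.
    rewrite (ZX oj b)//; last by rewrite bj.
    rewrite (ZX oi b)//; last by rewrite bj.
      by rewrite !mulr0 subrr.
    exact: ltn_trans lji.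
  case: ifPn => [/eqP ai|nai].
    have [bj|nbj] := ltnP b j.
      rewrite (ZX oj b)//; last by rewrite bj.
      rewrite (ZX oi b)//; last by rewrite bj.
        by rewrite !mulr0 addr0.
      exact: ltn_trans lji.
    have bj : b = cj.
      by apply/val_inj => /=; case/orP: h => [|/andP[/eqP]//]; rewrite ltnNge nbj.
    by rewrite bj.
  apply: ZX => //; case/orP: h => [->//|/andP[-> ai]]; apply/orP; right => /=.
  by rewrite ltn_neqAle -ltnS ai andbT; move: nai; rewrite -val_eqE.
have col j i : (i <= n)%N -> (j < m)%N ->
    forall X, Z j 0%N X -> exists2 O, givens_prod O & Z j i (O *m X).
  move=> + ljm; elim: i => [|i IH] lin X ZX.
    by exists 1%:M; [exact: givens_prod1|rewrite mul1mx].
  have [X1 h1 Z1] := IH (ltnW lin) X ZX.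
  have [X2 h2 Z2] := step j i lin ljm _ Z1.
  by exists (X2 *m X1); [exact: givens_prod_mul|rewrite -mulmxA].
have cols j : (j <= m)%N -> exists2 O, givens_prod O & Z j 0%N (O *m H).
  elim: j => [|j IH] ljm.
    exists 1%:M; first exact: givens_prod1.
    by move=> a b _; rewrite ltn0 ltn0 andbF.
  have [X1 h1 Z1] := IH (ltnW ljm).
  have [X2 h2 Z2] := col j n (leqnn n) ljm _ Z1.
  exists (X2 *m X1); first exact: givens_prod_mul.
  move=> a b ba; rewrite ltn0 andbF orbF ltnS leq_eqVlt => h.
  by rewrite -mulmxA; apply: Z2 => //; rewrite ltn_ord andbT orbC.
have [Q hQ ZQ] := cols m (leqnn m); exists Q => // i j ji.
by apply: ZQ => //; rewrite ltn_ord.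
Qed.

Lemma orthonormal_givens (R : realType) (n : nat) (V : 'M[R]_n) :
  orthonormal_cols V ->
  exists (G : 'M[R]_n) (d : 'rV[R]_n), [/\ givens_prod G,
    forall i, d 0 i ^+ 2 = 1 & V^T = diag_mx d *m G].
Proof.
move=> hV; have [G hG GV] := givens_triangularize V.
have hGo := givens_prod_orthonormal hG.
set W := G *m V; have hW : orthonormal_cols W := orthonormal_colsM hGo hV.
have hWT : W *m W^T = 1%:M := mulmx1C hW.
(* A matrix that is orthogonal and triangular is diagonal with entries of square 1. In column [i],
   entries above the diagonal vanish by induction and those below by triangularity, so
   [W i i ^+ 2 = 1]; the unit norm of row [i] then kills its other entries. *)
have W0 N (i : 'I_n) : (i < N)%N ->
    W i i ^+ 2 = 1 /\ forall j, j != i -> W i j = 0.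
  elim: N i => // N IH i iN.
  have Wii : W i i ^+ 2 = 1.
    have := congr1 (fun M : 'M[R]_n => M i i) hW; rewrite mxE [1%:M i i]mxE eqxx mulr1n.
    rewrite (bigD1 i)//= big1 => [|a ai]; first by rewrite mxE addr0 expr2.
    rewrite mxE; have [lai|] := ltnP a i.
      have [|_ ->] := IH a; first exact: leq_trans lai _.
        by rewrite mul0r.
      by rewrite eq_sym.
    rewrite leq_eqVlt => /orP[/eqP/val_inj ia|lia]; first by rewrite ia eqxx in ai.
    by rewrite GV// mul0r.
  split=> // j ji; have := congr1 (fun M : 'M[R]_n => M i i) hWT.
  rewrite mxE [1%:M i i]mxE eqxx mulr1n (bigD1 i)//= [W^T i i]mxE -expr2 Wii => /eqP.
  rewrite -subr_eq0 addrAC subrr add0r psumr_eq0 => [/allP/(_ j (mem_index_enum j))|a _].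
    by rewrite ji/= [W^T j i]mxE -expr2 sqrf_eq0 => /eqP.
  by rewrite [W^T a i]mxE -expr2 sqr_ge0.
exists G, (\row_i W i i); split => //.
  by move=> i; rewrite mxE; have [] := W0 i.+1 i (ltnSn i).
have -> : diag_mx (\row_i W i i) = W^T.
  apply/matrixP => i j; rewrite [W^T i j]mxE [LHS]mxE [(\row__ _) _ _]mxE.
  have [->|ij] := eqVneq i j; first by rewrite mulr1n.
  by rewrite mulr0n; have [_ ->] := W0 j.+1 j (ltnSn j).
by rewrite trmx_mul -mulmxA hGo mulmx1.
Qed.

(** * Gram-Schmidt projectors and dual vectors *)

(* Projector onto the orthogonal complement of the span of [gs].  The convention
   [0^-1 = 0] makes a linearly dependent vector harmless. *)
Fixpoint gs_proj (R : realType) (l : nat) (gs : seq 'cV[R]_l) : 'M[R]_l :=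
  if gs is g :: gs' then
    let u := gs_proj gs' *m g in
    gs_proj gs' - (nsq u)^-1 *: (u *m u^T)
  else 1%:M.

Lemma col_gram (R : realType) (l : nat) (u : 'cV[R]_l) : u^T *m u = (nsq u)%:M.
Proof.
apply/matrixP => i j; rewrite !ord1 [RHS]mxE eqxx mulr1n /nsq /fdot.
by rewrite /mxtrace big_ord1.
Qed.

Lemma gs_proj_is_proj (R : realType) (l : nat) (gs : seq 'cV[R]_l) :
  is_proj (gs_proj gs).
Proof.
elim: gs => [|g gs [PT PP]] /=; first by split; rewrite ?trmx1 ?mulmx1.
set P := gs_proj gs in PT PP *; set u := P *m g.
have Pu : P *m u = u by rewrite mulmxA PP.
have uP : u^T *m P = u^T by rewrite -[in RHS]Pu (trmx_mul P u) PT.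
split; first by rewrite linearB/= linearZ/= trmx_mul trmxK PT.
rewrite mulmxBl !mulmxBr PP -!scalemxAl -!scalemxAr.
rewrite [P *m (u *m u^T)]mulmxA Pu -[u *m u^T *m P]mulmxA uP.
rewrite [u *m u^T *m (u *m u^T)]mulmxA -[u *m u^T *m u]mulmxA col_gram.
rewrite mul_mx_scalar -scalemxAl !scalerA.
have [u0|u0] := eqVneq (nsq u) 0.
  by rewrite u0 invr0 !mul0r !scale0r !subr0.
by rewrite -mulrA mulVf// mulr1 subrr subr0.
Qed.

Lemma gs_projK (R : realType) (l : nat) (gs : seq 'cV[R]_l) (g : 'cV[R]_l) :
  g \in gs -> gs_proj gs *m g = 0.
Proof.
elim: gs => [//|h gs IH] /=; set P := gs_proj gs in IH *; set u := P *m h.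
have [PT PP] : is_proj P := gs_proj_is_proj gs.
rewrite inE mulmxBl -scalemxAl -mulmxA => /orP[/eqP ->|ggs]; last first.
  by rewrite IH// /u trmx_mul PT -(mulmxA h^T) IH// !mulmx0 scaler0 subr0.
have -> : u^T *m h = (nsq u)%:M.
  have uP : u^T *m P = u^T by rewrite /u trmx_mul PT -mulmxA PP.
  by rewrite -col_gram -[X in _ = _ *m X]/(P *m h) mulmxA uP.
rewrite mul_mx_scalar scalerA -/u.
have [u0|u0] := eqVneq (nsq u) 0; first by rewrite (nsq_eq0 u0) scaler0 subr0.
by rewrite mulVf// scale1r subrr.
Qed.

Lemma gs_proj_id (R : realType) (l : nat) (gs : seq 'cV[R]_l) (x : 'cV[R]_l) :
  (forall g, g \in gs -> g^T *m x = 0) -> gs_proj gs *m x = x.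
Proof.
elim: gs => [_|h gs IH hx] /=; first by rewrite mul1mx.
have Px : gs_proj gs *m x = x.
  by apply: IH => g ggs; apply: hx; rewrite inE ggs orbT.
have [PT _] := gs_proj_is_proj gs.
rewrite mulmxBl -scalemxAl -(mulmxA (_ *m h)) trmx_mul PT -(mulmxA h^T) Px.
rewrite hx ?mem_head//.
by rewrite mulmx0 scaler0 subr0.
Qed.

(* Bessel's inequality for the last rows of an orthogonal matrix that
   triangularizes [gs]. *)
Lemma gs_proj_lower (R : realType) (l : nat) (gs : seq 'cV[R]_l) :
  exists2 O : 'M[R]_l, givens_prod O & forall g : 'cV[R]_l,
    \sum_(c < l | (size gs <= c)%N) (O *m g) c 0 ^+ 2 <= nsq (gs_proj gs *m g).
Proof.
pose H : 'M[R]_(l, size gs) := \matrix_(i, j) gs`_j i 0.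
have [Q hQ QH] := givens_triangularize H; exists Q => // g.
have [PT PP] := gs_proj_is_proj gs.
have hQo := givens_prod_orthonormal hQ.
rewrite -(nsq_mull _ hQo) nsqE [leLHS]big_mkcond/=.
apply: ler_sum => c _; rewrite big_ord1; case: ifPn => sc; last exact: sqr_ge0.
suff -> : (Q *m (gs_proj gs *m g)) c 0 = (Q *m g) c 0 by [].
(* From index [size gs] on, the rows of [Q] are orthogonal to every vector of [gs], because [Q]
   triangularizes them. The projector fixes such rows, so it does not change coordinate [c]. *)
have Qc : gs_proj gs *m (row c Q)^T = (row c Q)^T.
  apply: gs_proj_id => h /(nthP 0)[a sa <-].
  apply/matrixP => i j; rewrite !ord1 mxE [RHS]mxE.
  have := QH c (Ordinal sa) (leq_trans sa sc); rewrite mxE => Qa.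
  rewrite -[RHS]Qa; apply: eq_bigr => b _; rewrite !mxE; exact: mulrC.
have rowc (X : 'cV[R]_l) : (Q *m X) c 0 = (row c Q *m X) 0 0.
  by rewrite -row_mul [RHS]mxE.
rewrite !rowc mulmxA; congr ((_ *m _) _ _).
by apply: trmx_inj; rewrite trmx_mul PT.
Qed.

Definition gs_dual (R : realType) (l : nat) (gs : seq 'cV[R]_l) (g : 'cV[R]_l)
    : 'cV[R]_l :=
  (nsq (gs_proj gs *m g))^-1 *: (gs_proj gs *m g).

Lemma nsq_gs_dual (R : realType) (l : nat) (gs : seq 'cV[R]_l) (g : 'cV[R]_l) :
  nsq (gs_dual gs g) = (nsq (gs_proj gs *m g))^-1.
Proof.
rewrite nsqZ; have [->|u0] := eqVneq (nsq (gs_proj gs *m g)) 0.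
  by rewrite invr0 mulr0.
by field.
Qed.

Lemma gs_dual_ortho (R : realType) (l : nat) (gs : seq 'cV[R]_l) (g h : 'cV[R]_l) :
  h \in gs -> h^T *m gs_dual gs g = 0.
Proof.
move=> hgs; have [PT _] := gs_proj_is_proj gs.
have hP : h^T *m gs_proj gs = 0 by rewrite -PT -trmx_mul gs_projK// trmx0.
by rewrite -scalemxAr mulmxA hP mul0mx scaler0.
Qed.

Lemma gs_dual_self (R : realType) (l : nat) (gs : seq 'cV[R]_l) (g : 'cV[R]_l) :
  nsq (gs_proj gs *m g) != 0 -> g^T *m gs_dual gs g = 1%:M.
Proof.
move=> u0; have [PT PP] := gs_proj_is_proj gs.
have -> : g^T *m gs_dual gs g = (nsq (gs_proj gs *m g))^-1 *: (nsq (gs_proj gs *m g))%:M.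
  rewrite -scalemxAr; congr (_ *: _).
  by rewrite -col_gram trmx_mul PT !mulmxA -(mulmxA g^T _ (gs_proj gs)) PP.
by rewrite scale_scalar_mx mulVf.
Qed.

(** * Gaussian integrals in the plane *)

Local Open Scope ereal_scope.

(** The integral of a nonnegative function is a supremum over the simple functions below it, hence
    monotone even for non-measurable functions. This is what permits an arbitrary selection
    [Ahat]. *)
Lemma ge0_le_integralT (d : measure_display) (T : measurableType d)
    (R : realType) (mu : {measure set T -> \bar R}) (f g : T -> \bar R) :
  (forall x, 0 <= f x) -> (forall x, f x <= g x) ->
  \int[mu]_x f x <= \int[mu]_x g x.
Proof.
move=> f0 fg; have g0 x : 0 <= g x by exact: le_trans (fg x).
rewrite !ge0_integralTE//; apply: le_ereal_sup => _ [h /= hf <-].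
by exists h => //= x; exact: le_trans (fg x).
Qed.

(** The Radon-Nikodym derivative and [normal_pdf] have the same integral over every measurable set,
    so they agree almost everywhere. *)
Lemma ge0_integral_normal_prob (R : realType) (m s : R)
    (f : R -> \bar R) :
  measurable_fun setT f -> (forall x, 0 <= f x) ->
  \int[normal_prob m s]_x f x =
  \int[lebesgue_measure]_x (f x * (normal_pdf m s x)%:E).
Proof.
move=> mf f0; have dom := normal_prob_dominates m s.
rewrite -(Radon_Nikodym_SigmaFinite.change_of_variables dom f0 measurableT mf).
apply: ge0_ae_eq_integral => //.
- apply: emeasurable_funM => //.
  exact: measurable_int (Radon_Nikodym_SigmaFinite.f_integrable dom).
- apply: emeasurable_funM => //; apply/measurable_EFinP.
  exact: measurable_normal_pdf.
- by move=> x _; rewrite mule_ge0// Radon_Nikodym_SigmaFinite.f_ge0.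
- by move=> x _; rewrite mule_ge0// lee_fin normal_pdf_ge0.
- apply: ae_eqe_mul2l; apply: integral_ae_eq => //.
  + exact: Radon_Nikodym_SigmaFinite.f_integrable.
  + by apply/measurable_EFinP; exact: measurable_normal_pdf.
  + by move=> E _ mE; rewrite -Radon_Nikodym_SigmaFinite.f_integral.
Qed.

Lemma lebesgue_measure_shift (R : realType) (a : R) (A : set R) :
  measurable A ->
  pushforward lebesgue_measure ((fun x => x + a)%R : measurableTypeR R -> measurableTypeR R) A
  = lebesgue_measure A.
Proof.
have ms : measurable_fun setT
    ((fun x => x + a)%R : measurableTypeR R -> measurableTypeR R).
  exact: measurable_funD.
move=> mA; apply/esym/lebesgue_measure_unique => //= _ [[u v]] _ <-.
rewrite /pushforward (_ : _ @^-1` _ = `](u - a)%R, (v - a)%R]%classic); last first.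
  by apply/seteqP; split=> x /=; rewrite !in_itv/= ltrBlDr lerBrDr.
by rewrite !lebesgue_measure_itv/= !lte_fin ltrD2r -!EFinB opprB addrA subrK.
Qed.

Lemma ge0_integral_shift (R : realType) (a : R) (f : R -> \bar R) :
  measurable_fun [set: R] f -> (forall x, 0 <= f x) ->
  \int[lebesgue_measure]_x f (x + a)%R = \int[lebesgue_measure]_x f x.
Proof.
move=> mf f0.
have ms : measurable_fun setT
    ((fun x => x + a)%R : measurableTypeR R -> measurableTypeR R).
  exact: measurable_funD.
transitivity (\int[pushforward lebesgue_measure
    ((fun x => x + a)%R : measurableTypeR R -> measurableTypeR R)]_x f x).
  by rewrite ge0_integral_pushforward.
by apply: eq_measure_integral => A mA _; exact: lebesgue_measure_shift.
Qed.

Lemma ge0_integral_shear_snd (R : realType) (b : R) (h : R * R -> \bar R) :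
  measurable_fun setT h -> (forall z, 0 <= h z) ->
  \int[lebesgue_measure]_x \int[lebesgue_measure]_y h (x, y + b * x)%R =
  \int[lebesgue_measure]_x \int[lebesgue_measure]_y h (x, y).
Proof.
move=> mh h0; apply: eq_integral => x _.
rewrite (ge0_integral_shift (b * x)%R (f := fun y => h (x, y)))//.
exact: measurableT_comp.
Qed.

(** For fixed [y] the shear translates [x]; Tonelli makes [x] the inner variable and then restores
    the order. *)
Lemma ge0_integral_shear_fst (R : realType) (a : R) (h : R * R -> \bar R) :
  measurable_fun setT h -> (forall z, 0 <= h z) ->
  \int[lebesgue_measure]_x \int[lebesgue_measure]_y h (x + a * y, y)%R =
  \int[lebesgue_measure]_x \int[lebesgue_measure]_y h (x, y).
Proof.
move=> mh h0.
have msh : measurable_fun setT (fun z : R * R => h (z.1 + a * z.2, z.2)%R).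
  apply: (measurableT_comp mh); apply: measurable_fun_pair => //.
  apply: measurable_funD => //; exact: measurable_funM.
transitivity (\int[lebesgue_measure]_y \int[lebesgue_measure]_x
  h (x + a * y, y)%R).
  exact: (@fubini_tonelli _ _ _ _ R lebesgue_measure lebesgue_measure
    (fun z : R * R => h (z.1 + a * z.2, z.2)%R)).
transitivity (\int[lebesgue_measure]_y \int[lebesgue_measure]_x h (x, y));
  last exact: (esym (@fubini_tonelli _ _ _ _ R lebesgue_measure lebesgue_measure h mh h0)).
apply: eq_integral => y _.
rewrite (ge0_integral_shift (a * y)%R (f := fun x => h (x, y)))//.
exact: measurableT_comp.
Qed.

(** The rotation of angle [theta] is the composite of a horizontal shear by [- tan (theta / 2)], a
    vertical one by [sin theta], and the first one again. Here [t] is [- tan (theta / 2)], and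
    [0 <= c] keeps its denominator [1 + c] away from zero. *)
Lemma ge0_integral_rotation (R : realType) (c s : R) (h : R * R -> \bar R) :
  (0 <= c)%R -> (c ^+ 2 + s ^+ 2 = 1)%R ->
  measurable_fun setT h -> (forall z, 0 <= h z) ->
  \int[lebesgue_measure]_x \int[lebesgue_measure]_y
    h (c * x - s * y, s * x + c * y)%R =
  \int[lebesgue_measure]_x \int[lebesgue_measure]_y h (x, y).
Proof.
move=> c0 cs mh h0; pose t := (- (s / (1 + c)))%R.
have c1 : (1 + c != 0)%R by rewrite gt_eqF// ltr_pwDl.
pose h1 (z : R * R) := h (z.1 + t * z.2, z.2)%R.
pose h2 (z : R * R) := h1 (z.1, z.2 + s * z.1)%R.
have mh1 : measurable_fun setT h1.
  apply: (measurableT_comp mh); apply: measurable_fun_pair => //.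
  apply: measurable_funD => //; exact: measurable_funM.
have mh2 : measurable_fun setT h2.
  apply: (measurableT_comp mh1); apply: measurable_fun_pair => //.
  apply: measurable_funD => //; exact: measurable_funM.
have h10 z : 0 <= h1 z by exact: h0.
have h20 z : 0 <= h2 z by exact: h0.
rewrite -(ge0_integral_shear_fst t mh h0) -(ge0_integral_shear_snd s mh1 h10).
rewrite -(ge0_integral_shear_fst t mh2 h20).
apply: eq_integral => x _; apply: eq_integral => y _.
have s2 : (s ^+ 2 = (1 - c) * (1 + c))%R.
  by transitivity (1 - c ^+ 2)%R; [rewrite -cs|]; ring.
rewrite /h2 /h1 /=; congr (h (_, _)).
  rewrite (_ : x + t * y + t * (y + s * (x + t * y)) =
    (1 - s ^+ 2 / (1 + c)) * x - s * (2 - s ^+ 2 / (1 + c)) / (1 + c) * y)%R.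
    by rewrite s2 mulfK//; field.
  by rewrite /t; field.
rewrite (_ : y + s * (x + t * y) = s * x + (1 - s ^+ 2 / (1 + c)) * y)%R.
  by rewrite s2 mulfK//; ring.
by rewrite /t; field.
Qed.

Lemma ge0_integral_normal_prob2 (R : realType) (f : R * R -> \bar R) :
  measurable_fun setT f -> (forall z, 0 <= f z) ->
  \int[normal_prob 0 1]_x \int[normal_prob 0 1]_y f (x, y) =
  \int[lebesgue_measure]_x \int[lebesgue_measure]_y
    (f (x, y) * (normal_pdf 0 1 x * normal_pdf 0 1 y)%:E).
Proof.
move=> mf f0; rewrite ge0_integral_normal_prob//; last first.
- by move=> x; apply: integral_ge0.
- exact: (measurable_fun_fubini_tonelli_F (m2 := normal_prob 0 1) f).
apply: eq_integral => x _.
have mfx : measurable_fun setT (fun y => f (x, y)) by exact: measurableT_comp.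
have mpdf : measurable_fun setT (EFin \o @normal_pdf R 0 1).
  by apply/measurable_EFinP; exact: measurable_normal_pdf.
rewrite ge0_integral_normal_prob// -ge0_integralZr//.
- by apply: eq_integral => y _; rewrite EFinM (muleC (normal_pdf 0 1 x)%:E) muleA.
- exact: emeasurable_funM.
- by move=> y _; rewrite mule_ge0// lee_fin normal_pdf_ge0.
- by rewrite lee_fin normal_pdf_ge0.
Qed.

Lemma normal_pdf01M (R : realType) (u v : R) :
  (normal_pdf 0 1 u * normal_pdf 0 1 v =
   normal_peak 1 ^+ 2 * expR (- (u ^+ 2 + v ^+ 2) / 2))%R.
Proof.
rewrite !normal_pdfE ?oner_neq0// /normal_fun mulrACA -expr2 -expRD expr1n.
by rewrite !subr0; congr (_ * expR _)%R; field.
Qed.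

(** The joint density depends on [x ^+ 2 + y ^+ 2] only, so the claim reduces to the invariance of
    Lebesgue measure. *)
Lemma normal_prob_rotation (R : realType) (c s : R) (f : R * R -> \bar R) :
  (0 <= c)%R -> (c ^+ 2 + s ^+ 2 = 1)%R ->
  measurable_fun setT f -> (forall z, 0 <= f z) ->
  \int[normal_prob 0 1]_x \int[normal_prob 0 1]_y
    f (c * x - s * y, s * x + c * y)%R =
  \int[normal_prob 0 1]_x \int[normal_prob 0 1]_y f (x, y).
Proof.
move=> c0 cs mf f0.
pose h (z : R * R) := f z * (normal_pdf 0 1 z.1 * normal_pdf 0 1 z.2)%:E.
have mpdf : measurable_fun setT (@normal_pdf R 0 1) := measurable_normal_pdf 0 1.
have mh : measurable_fun setT h.
  apply: emeasurable_funM => //; apply/measurable_EFinP.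
  by apply: measurable_funM; exact: measurableT_comp.
have h0 z : 0 <= h z by rewrite mule_ge0// lee_fin mulr_ge0// normal_pdf_ge0.
rewrite (ge0_integral_normal_prob2 mf)//.
rewrite (@ge0_integral_normal_prob2 _ (fun z : R * R =>
  f (c * z.1 - s * z.2, s * z.1 + c * z.2)%R))//; last first.
  apply: (measurableT_comp mf); apply: measurable_fun_pair.
    by apply: measurable_funB; exact: measurable_funM.
  by apply: measurable_funD; exact: measurable_funM.
rewrite -[RHS](ge0_integral_rotation c0 cs mh h0).
apply: eq_integral => x _; apply: eq_integral => y _ /=.
rewrite /h /=; congr (_ * _%:E).
rewrite !normal_pdf01M; congr (_ * expR _)%R.
have -> : ((c * x - s * y) ^+ 2 + (s * x + c * y) ^+ 2 =
  (c ^+ 2 + s ^+ 2) * (x ^+ 2 + y ^+ 2))%R by ring.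
by rewrite cs mul1r.
Qed.

(** * Gaussian families and independence *)

(** For fixed [B], both sides are finite measures in [A] that agree on a pi-system containing the
    whole space. *)
Lemma pi_system_indep (d : measure_display) (T : measurableType d)
    (R : realType) (P : probability T R) (G : set (set T)) (B : set T) :
  G `<=` measurable -> setI_closed G -> G setT -> measurable B ->
  (forall A, G A -> P (A `&` B) = P A * P B) ->
  forall A, <<s G >> A -> P (A `&` B) = P A * P B.
Proof.
move=> Gm GI GT mB h A sA.
have PB0 : (0 <= fine (P B))%R by rewrite fine_ge0.
have PBE : P B = (fine (P B))%:E by rewrite fineK// fin_num_measure.
pose r := NngNum PB0.
rewrite -[LHS]/(mrestr P mB A) PBE muleC -[RHS]/(mscale r P A).
apply: (g_sigma_algebra_measure_unique G Gm (fun _ => setT)) => //.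
- by rewrite bigcup_const//; exists 0%N.
- move=> C GC; rewrite /= /mrestr /mscale h// muleC; congr (_ * _); exact: PBE.
- by move=> k; rewrite /= /mrestr setTI -ge0_fin_numE// fin_num_measure.
Qed.

Lemma pi_system_indep2 (d : measure_display) (T : measurableType d)
    (R : realType) (P : probability T R) (G H : set (set T)) :
  G `<=` measurable -> setI_closed G -> G setT ->
  H `<=` measurable -> setI_closed H -> H setT ->
  (forall A B, G A -> H B -> P (A `&` B) = P A * P B) ->
  forall A B, <<s G >> A -> <<s H >> B -> P (A `&` B) = P A * P B.
Proof.
move=> Gm GI GT Hm HI HT h A B sA sB.
have sHm : <<s H >> `<=` measurable.
  by apply: smallest_sub => //; exact: sigma_algebra_measurable.
apply: (pi_system_indep Gm GI GT (sHm _ sB)) => // C GC.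
rewrite setIC muleC; apply: (pi_system_indep Hm HI HT (Gm _ GC)) => // D HD.
by rewrite setIC muleC; exact: h.
Qed.

(** Independence identifies the joint law with the product of the marginal laws on rectangles, hence
    everywhere; Tonelli then separates the variables. *)
Lemma ge0_integral_decouple (d d1 d2 : measure_display) (T : measurableType d)
    (T1 : measurableType d1) (T2 : measurableType d2) (R : realType)
    (P : probability T R) (X : {RV P >-> T1}) (Y : {RV P >-> T2})
    (f : T1 * T2 -> \bar R) :
  (forall A B, measurable A -> measurable B ->
     P (X @^-1` A `&` Y @^-1` B) = P (X @^-1` A) * P (Y @^-1` B)) ->
  measurable_fun setT f -> (forall z, 0 <= f z) ->
  \int[P]_w f (X w, Y w) = \int[P]_w1 \int[P]_w2 f (X w1, Y w2).
Proof.
move=> ind mf f0.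
have mXY : measurable_fun setT (fun w => (X w, Y w)) by exact: measurable_fun_pair.
transitivity (\int[pushforward P (fun w => (X w, Y w))]_z f z).
  by rewrite ge0_integral_pushforward.
transitivity (\int[distribution P X \x distribution P Y]_z f z).
  apply: eq_measure_integral => A mA _; apply/esym.
  apply: (@product_measure_unique _ _ _ _ _ (distribution P X) (distribution P Y)) => //.
rewrite fubini_tonelli1//.
have mF := measurable_fun_fubini_tonelli_F (m2 := distribution P Y) f mf f0.
rewrite ge0_integral_distribution//; last by move=> x; apply: integral_ge0.
apply: eq_integral => w _; rewrite /= /fubini_F ge0_integral_distribution//.
exact: measurableT_comp.
Qed.

(** One formula carries both the laws and the independence: subfamilies are reached by taking
    [B i = setT] elsewhere. Plain functions are used so that transformed families need no
    repackaging as random variables. *)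
Definition gaussian_family (d : measure_display) (T : measurableType d)
    (R : realType) (P : probability T R) (I : finType) (X : I -> T -> R) : Prop :=
  (forall i, measurable_fun setT (X i)) /\
  forall B : I -> set R, (forall i, measurable (B i)) ->
    P (\bigcap_i (X i @^-1` B i)) = \prod_i normal_prob 0 1 (B i).

(** A pi-system generating the sigma-algebra of the variables with index in [J]. It lives on [T]
    itself, so conditioning needs no product space. *)
Definition cylinders (T : Type) (R : realType) (I : Type) (X : I -> T -> R)
    (J : pred I) : set (set T) :=
  [set A | exists B : I -> set R, [/\ forall i, measurable (B i),
     forall i, ~~ J i -> B i = setT & A = \bigcap_i (X i @^-1` B i)]].

Lemma cylindersT (T : Type) (R : realType) (I : Type) (X : I -> T -> R)
    (J : pred I) : cylinders X J setT.
Proof. by exists (fun _ => setT); split => //; rewrite bigcapT. Qed.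

Lemma cylindersI (T : Type) (R : realType) (I : Type) (X : I -> T -> R)
    (J : pred I) : setI_closed (cylinders X J).
Proof.
move=> _ _ [B [mB BT ->]] [C [mC CT ->]]; exists (fun i => B i `&` C i); split.
- by move=> i; exact: measurableI.
- by move=> i iJ; rewrite BT// CT// setIT.
- by rewrite -bigcapI; apply: eq_bigcapr => i _; rewrite preimage_setI.
Qed.

Lemma cylinders_measurable (d : measure_display) (T : measurableType d)
    (R : realType) (I : finType) (X : I -> T -> R) (J : pred I) :
  (forall i, measurable_fun setT (X i)) -> cylinders X J `<=` measurable.
Proof.
move=> mX _ [B [mB _ ->]]; apply: fin_bigcap_measurable => //.
by move=> i _; rewrite -[_ @^-1` _]setTI; exact: mX.
Qed.

Lemma cylinders_indep (d : measure_display) (T : measurableType d)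
    (R : realType) (P : probability T R) (I : finType) (X : I -> T -> R)
    (J K : pred I) : gaussian_family P X -> (forall i, ~~ (J i && K i)) ->
  forall A B, <<s cylinders X J >> A -> <<s cylinders X K >> B ->
  P (A `&` B) = P A * P B.
Proof.
move=> [mX PX] JK.
apply: pi_system_indep2;
  [exact: cylinders_measurable|exact: cylindersI|exact: cylindersT
  |exact: cylinders_measurable|exact: cylindersI|exact: cylindersT|].
move=> _ _ [B [mB BT ->]] [C [mC CT ->]].
rewrite !PX// -bigcapI.
under eq_bigcapr do rewrite -preimage_setI.
rewrite (PX (fun i => B i `&` C i)); last by move=> i; exact: measurableI.
rewrite -big_split/=; apply: eq_bigr => i _.
have := JK i; rewrite negb_and => /orP[/BT ->|/CT ->].
  by rewrite setTI probability_setT mul1e.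
by rewrite setIT probability_setT mule1.
Qed.

Lemma measurable_cylinders (d : measure_display) (T : measurableType d)
    (R : realType) (I : eqType) (X : I -> T -> R) (J : pred I) (i : I) : J i ->
  measurable_fun setT (X i : g_sigma_algebraType (cylinders X J) -> R).
Proof.
move=> Ji _ A mA; apply: sub_sigma_algebra; rewrite setTI.
exists (fun j => if j == i then A else setT); split.
- by move=> j; case: ifP.
- by move=> j; case: eqP => // ->; rewrite Ji.
- apply/seteqP; split => [w Aw j _|w /(_ i Logic.I)]; last by rewrite eqxx.
  by case: eqP => // ->.
Qed.

(** Each argument of [f] ranges over all of [T]; measurability for the generated sigma-algebras is
    what says that it depends on the variables in [J], respectively [K], alone. The two independent
    random variables are the identity of [T], seen as a map into these two coarser spaces. *)
Lemma gaussian_decouple (d : measure_display) (T : measurableType d)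
    (R : realType) (P : probability T R) (I : finType) (X : I -> T -> R)
    (J K : pred I)
    (f : g_sigma_algebraType (cylinders X J) * g_sigma_algebraType (cylinders X K)
         -> \bar R) :
  gaussian_family P X -> (forall i, ~~ (J i && K i)) ->
  measurable_fun setT f -> (forall z, 0 <= f z) ->
  \int[P]_w f (w, w) = \int[P]_w1 \int[P]_w2 f (w1, w2).
Proof.
move=> gX JK mf f0.
have mid (L : pred I) :
    measurable_fun setT (id : T -> g_sigma_algebraType (cylinders X L)).
  move=> _ A sA; rewrite setTI preimage_id.
  apply: (smallest_sub _ _ sA); first exact: sigma_algebra_measurable.
  by apply: cylinders_measurable; case: gX.
pose idJ := isMeasurableFun.Build _ _ _ _ _ (mid J).
pose idK := isMeasurableFun.Build _ _ _ _ _ (mid K).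
pose XJ : {RV P >-> g_sigma_algebraType (cylinders X J)} := HB.pack id idJ.
pose XK : {RV P >-> g_sigma_algebraType (cylinders X K)} := HB.pack id idK.
apply: (@ge0_integral_decouple _ _ _ _ _ _ _ P XJ XK f) => //.
by move=> A B sA sB; exact: (cylinders_indep gX JK).
Qed.

Lemma gaussian_family_law (d : measure_display) (T : measurableType d)
    (R : realType) (P : probability T R) (I : finType) (X : I -> T -> R)
    (i : I) (B : set R) : gaussian_family P X -> measurable B ->
  P (X i @^-1` B) = normal_prob 0 1 B.
Proof.
move=> [mX PX] mB; pose C j := if j == i then B else setT.
have := PX C; rewrite (bigD1 i)//= big1 ?mule1; last first.
  by move=> j /negbTE ji; rewrite /C ji probability_setT.
have -> : C i = B by rewrite /C eqxx.
move=> <-; last by move=> j; rewrite /C; case: ifP.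
congr (P _); apply/seteqP; split=> [w Bw j _|w /(_ i Logic.I)]; rewrite /C.
  by case: eqP => // ->.
by rewrite eqxx.
Qed.

Lemma gaussian_family_integral (d : measure_display) (T : measurableType d)
    (R : realType) (P : probability T R) (I : finType) (X : I -> T -> R)
    (i : I) (f : R -> \bar R) : gaussian_family P X ->
  measurable_fun setT f -> (forall x, 0 <= f x) ->
  \int[P]_w f (X i w) = \int[normal_prob 0 1]_x f x.
Proof.
move=> gX mf f0; have mX := gX.1 i.
pose Xi : {RV P >-> measurableTypeR R} :=
  HB.pack (X i) (isMeasurableFun.Build _ _ T (measurableTypeR R) _ mX).
rewrite -[LHS](ge0_integral_distribution Xi mf f0).
apply: eq_measure_integral.
by move=> A mA _; exact: (gaussian_family_law i gX mA).
Qed.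

Lemma gaussian_family_integral2 (d : measure_display) (T : measurableType d)
    (R : realType) (P : probability T R) (I : finType) (X : I -> T -> R)
    (i j : I) (f : R * R -> \bar R) : gaussian_family P X -> i != j ->
  measurable_fun setT f -> (forall x, 0 <= f x) ->
  \int[P]_w f (X i w, X j w) =
  \int[normal_prob 0 1]_x \int[normal_prob 0 1]_y f (x, y).
Proof.
move=> gX ij mf f0; have [mX _] := gX.
pose Xi : {RV P >-> R} := HB.pack (X i) (isMeasurableFun.Build _ _ _ _ _ (mX i)).
pose Xj : {RV P >-> R} := HB.pack (X j) (isMeasurableFun.Build _ _ _ _ _ (mX j)).
rewrite (ge0_integral_decouple (X := Xi) (Y := Xj))//; last first.
  move=> A B mA mB; apply: (@cylinders_indep _ _ _ _ _ _ (pred1 i) (pred1 j) gX).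
  - by move=> k /=; case: (eqVneq k i) => //= ->; rewrite (negbTE ij).
  - rewrite -[_ @^-1` _]setTI.
    by apply: (@measurable_cylinders _ _ _ _ X (pred1 i) i) => //=.
  - rewrite -[_ @^-1` _]setTI.
    by apply: (@measurable_cylinders _ _ _ _ X (pred1 j) j) => //=.
have mF := measurable_fun_fubini_tonelli_F (m2 := normal_prob 0 1) f mf f0.
rewrite -(gaussian_family_integral i gX mF); last first.
  by move=> x; apply: integral_ge0.
apply: eq_integral => w _; rewrite /fubini_F.
by rewrite -(gaussian_family_integral j gX)//; exact: measurableT_comp.
Qed.

Lemma measurable_fun_lin2 (d : measure_display) (T : measurableType d)
    (R : realType) (f g : T -> R) (a b : R) :
  measurable_fun setT f -> measurable_fun setT g ->
  measurable_fun setT (fun w => a * f w + b * g w)%R.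
Proof.
move=> mf mg; apply: measurable_funD; apply: measurable_funM => //;
  exact: measurable_cst.
Qed.

Lemma gaussian_family_rotation (d : measure_display) (T : measurableType d)
    (R : realType) (P : probability T R) (I : finType) (X : I -> T -> R)
    (a b : I) (c s : R) : gaussian_family P X -> a != b ->
  (0 <= c)%R -> (c ^+ 2 + s ^+ 2 = 1)%R ->
  gaussian_family P (fun i w => if i == a then c * X a w - s * X b w
    else if i == b then s * X a w + c * X b w else X i w)%R.
Proof.
move=> gX ab c0 cs; have [mX PX] := gX.
have ba : (b == a) = false by rewrite eq_sym (negbTE ab).
split.
  move=> i; case: (i == a) => /=.
    rewrite (_ : (fun _ => _) = fun w => c * X a w + - s * X b w)%R.
      exact: measurable_fun_lin2.
    by apply/funext => w; rewrite mulNr.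
  case: (i == b) => /=; last exact: mX.
  exact: measurable_fun_lin2.
move=> B mB; pose Y i w := (if i == a then c * X a w - s * X b w
  else if i == b then s * X a w + c * X b w else X i w)%R.
rewrite -[\bigcap_i _]/(\bigcap_i (Y i @^-1` B i)).
pose J := [pred i : I | (i == a) || (i == b)].
(* The event is cut into a part [E2] that sees only the two rotated variables and a part [E1] that
   sees only the others. They are independent, and only [E2] needs the plane rotation. *)
pose E2 := Y a @^-1` B a `&` Y b @^-1` B b.
pose C i := if J i then setT else B i.
pose E1 := \bigcap_i (X i @^-1` C i).
have -> : \bigcap_i (Y i @^-1` B i) = E2 `&` E1.
  apply/seteqP; split=> [w h|w [[ha hb] h1] i _].
    split; first by split; exact: h.
    move=> i _; rewrite /C; case: ifPn => // Ji; have := h i Logic.I.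
    by move: Ji; rewrite /Y /= negb_or => /andP[/negbTE -> /negbTE ->].
  case: (boolP (J i)) => [/orP[/eqP ->//|/eqP ->//]|Ji].
  have := h1 i Logic.I; rewrite /C (negbTE Ji).
  by move: Ji; rewrite /Y /= negb_or => /andP[/negbTE -> /negbTE ->].
have YaE : Y a = (fun w => c * X a w + - s * X b w)%R.
  by apply/funext => w; rewrite /Y eqxx mulNr.
have YbE : Y b = (fun w => s * X a w + c * X b w)%R.
  by apply/funext => w; rewrite /Y ba eqxx.
have Ja : J a by rewrite /J /= eqxx.
have Jb : J b by rewrite /J /= eqxx orbT.
have mXa := @measurable_cylinders _ _ _ _ X J _ Ja.
have mXb := @measurable_cylinders _ _ _ _ X J _ Jb.
rewrite (cylinders_indep gX (J := J) (K := predC J)); last 3 first.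
- by move=> i /=; case: (_ || _).
- have mYa : measurable_fun setT (Y a : g_sigma_algebraType (cylinders X J) -> R).
    by rewrite YaE; exact: measurable_fun_lin2.
  have mYb : measurable_fun setT (Y b : g_sigma_algebraType (cylinders X J) -> R).
    by rewrite YbE; exact: measurable_fun_lin2.
  have := mYa measurableT _ (mB a); have := mYb measurableT _ (mB b).
  rewrite !setTI => h1 h2.
  exact: (@measurableI _ (g_sigma_algebraType (cylinders X J)) _ _ h2 h1).
- apply: sub_sigma_algebra; exists C; split=> // i.
    by rewrite /C; case: ifP.
  by move=> /negPn Ji; rewrite /C Ji.
rewrite PX; last by move=> i; rewrite /C; case: ifP.
have mE2 : measurable E2.
  have mYa : measurable_fun setT (Y a).
    by rewrite YaE; exact: measurable_fun_lin2.
  have mYb : measurable_fun setT (Y b).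
    by rewrite YbE; exact: measurable_fun_lin2.
  have := mYa measurableT _ (mB a); have := mYb measurableT _ (mB b).
  rewrite !setTI => h1 h2; exact: measurableI.
have PE2 : P E2 = normal_prob 0 1 (B a) * normal_prob 0 1 (B b).
  pose f (z : R * R) : \bar R := (\1_(B a `*` B b) z)%:E.
  have mf : measurable_fun setT f.
    by apply/measurable_EFinP; apply: measurable_indic; exact: measurableX.
  have f0 z : 0 <= f z by rewrite lee_fin indicE.
  pose frot (z : R * R) := f (c * z.1 - s * z.2, s * z.1 + c * z.2)%R.
  have mfrot : measurable_fun setT frot.
    apply: (measurableT_comp mf); apply: measurable_fun_pair.
      by apply: measurable_funB; exact: measurable_funM.
    by apply: measurable_funD; exact: measurable_funM.
  transitivity (\int[P]_w frot (X a w, X b w)).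
    transitivity (\int[P]_w (\1_E2 w)%:E); first by rewrite integral_indic// setIT.
    apply: eq_integral => w _.
    rewrite /frot /f /= -mulNr !indicE; congr ((nat_of_bool _)%:R%:E).
    apply/idP/idP; rewrite !inE /E2 YaE YbE /=; tauto.
  rewrite (gaussian_family_integral2 gX ab mfrot (fun z => f0 _)).
  rewrite (normal_prob_rotation c0 cs mf f0).
  rewrite -(@product_measure1E _ _ _ _ _ (normal_prob 0 1) (normal_prob 0 1) _ _ (mB a) (mB b)).
  transitivity (\int[normal_prob 0 1 \x normal_prob 0 1]_z f z).
    by rewrite fubini_tonelli1.
  have mBB : measurable (B a `*` B b : set (measurableTypeR R * measurableTypeR R)).
    exact: (@measurableX _ _ (measurableTypeR R) (measurableTypeR R) _ _ (mB a) (mB b)).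
  by rewrite integral_indic// setIT.
have bna : b != a by rewrite eq_sym.
rewrite PE2 [RHS](bigD1 a)//= (bigD1 b bna)/=.
rewrite muleA; congr (_ * _).
rewrite (bigD1 a)//= (bigD1 b bna)/=.
rewrite {1 2}/C Ja Jb !probability_setT !mul1e.
apply: eq_bigr => i /andP[/negbTE ia /negbTE ib].
by rewrite /C /J /= ia ib.
Qed.

Lemma gaussian_family_sub (d : measure_display) (T : measurableType d)
    (R : realType) (P : probability T R) (I K : finType) (X : I -> T -> R)
    (f : K -> I) : gaussian_family P X -> injective f ->
  gaussian_family P (fun k => X (f k)).
Proof.
move=> [mX PX] fI; split=> [k|B mB]; first exact: mX.
pose C i := if [pick k | f k == i] is Some k then B k else setT.
have Cf k : C (f k) = B k.
  by rewrite /C; case: pickP => [j /eqP/fI ->//|/(_ k)]; rewrite eqxx.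
have CN i : (forall k, f k != i) -> C i = setT.
  by move=> h; rewrite /C; case: pickP => // k; rewrite (negbTE (h k)).
have -> : \bigcap_k (X (f k) @^-1` B k) = \bigcap_i (X i @^-1` C i).
  apply/seteqP; split=> [w h i _|w h k _]; last by rewrite -Cf; exact: h.
  rewrite /C; case: pickP => // k /eqP <-; exact: h.
rewrite PX; last by move=> i; rewrite /C; case: pickP.
rewrite (bigID (fun i => [exists k, f k == i]))/= [X in _ * X]big1 ?mule1.
  rewrite (reindex_omap f (fun i => [pick k | f k == i])); last first.
    move=> i /existsP[k fk]; case: pickP => [j /eqP <-//|/(_ k)].
    by rewrite fk.
  apply: eq_big => k; last by rewrite Cf.
  apply/andP; split; first by apply/existsP; exists k.
  by case: pickP => [j /eqP/fI ->//|/(_ k)]; rewrite eqxx.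
move=> i /existsPn h; rewrite CN ?probability_setT//.
Qed.

Lemma gaussian_family_ext (d : measure_display) (T : measurableType d)
    (R : realType) (P : probability T R) (I : finType) (X Y : I -> T -> R) :
  gaussian_family P X -> (forall i w, X i w = Y i w) -> gaussian_family P Y.
Proof.
move=> gX XY; suff -> : Y = X by [].
by apply/funext => i; apply/funext => w; rewrite XY.
Qed.

Lemma gaussian_family_givens (d : measure_display) (T : measurableType d)
    (R : realType) (P : probability T R) (n m : nat)
    (X : 'I_n * 'I_m -> T -> R) (G : 'M[R]_n) :
  gaussian_family P X -> givens_prod G ->
  gaussian_family P (fun ij w =>
    (G *m (\matrix_(i, j) X (i, j) w)) ij.1 ij.2).
Proof.
move=> + hG; elim: hG X => [X gX|a b c s O ab c0 cs _ IH X gX].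
  by apply: gaussian_family_ext gX _ => -[i j] w /=; rewrite mul1mx mxE.
have {IH gX} := IH X gX; set Y := fun ij w => _ => gY.
(* A Givens rotation acts on whole rows, while [gaussian_family_rotation] treats one pair of
   entries. [Z] is the intermediate family in which only the listed columns have been rotated. *)
pose Z (cs : seq 'I_m) (ij : 'I_n * 'I_m) (w : T) :=
  if ij.2 \in cs then
    (if ij.1 == a then c * Y (a, ij.2) w - s * Y (b, ij.2) w
     else if ij.1 == b then s * Y (a, ij.2) w + c * Y (b, ij.2) w
     else Y ij w)%R
  else Y ij w.
have gZ cols : uniq cols -> gaussian_family P (Z cols).
  elim: cols => [_|j cols IH /= /andP[jcols /IH gZ]].
    exact: (gaussian_family_ext gY).
  have abj : (a, j) != (b, j) by rewrite xpair_eqE eqxx andbT.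
  apply: (gaussian_family_ext (gaussian_family_rotation gZ abj c0 cs)).
  move=> [i k] w; rewrite /Z /= !(negbTE jcols) !xpair_eqE inE.
  case: (eqVneq k j) => [->|kj] /=; last by rewrite !andbF.
  by rewrite (negbTE jcols) !andbT.
apply: (gaussian_family_ext (gZ (enum 'I_m) (enum_uniq _))).
by move=> [i j] w; rewrite /Z mem_enum /= -mulmxA givens_mulE.
Qed.

(** The quarter turn sends [(x, y)] to [(- y, x)]; applied to a function of the first coordinate it
    gives the symmetry. *)
Lemma normal_prob_opp (R : realType) (B : set R) : measurable B ->
  normal_prob 0 1 [set x : R | B (- x)%R] = normal_prob 0 1 B.
Proof.
move=> mB; pose f (z : R * R) : \bar R := (\1_B z.1)%:E.
have mf : measurable_fun setT f.
  by apply/measurable_EFinP; apply: measurableT_comp.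
have f0 z : 0 <= f z by rewrite lee_fin indicE.
have cs : (0 ^+ 2 + 1 ^+ 2 = 1 :> R)%R by rewrite expr0n expr1n add0r.
have mNB : measurable [set x : R | B (- x)%R].
  have mN : measurable_fun setT (fun x : R => - x)%R by exact: measurableT_comp.
  by have := mN measurableT _ mB; rewrite setTI.
have cst1 (r : \bar R) : \int[@normal_prob R 0 1]_x r = r.
  by rewrite integral_cst// [X in _ * X]probability_setT mule1.
have ind (A : set R) : measurable A ->
    \int[normal_prob 0 1]_x (\1_A x)%:E = normal_prob 0 1 A.
  by move=> mA; rewrite integral_indic// setIT.
transitivity (\int[normal_prob 0 1]_x \int[normal_prob 0 1]_y
    f (0 * x - 1 * y, 1 * x + 0 * y)%R); last first.
  rewrite (normal_prob_rotation (lexx 0%R) cs mf f0) -[RHS]ind//.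
  by apply: eq_integral => x _; rewrite /f /=; exact: cst1.
rewrite -[LHS]cst1; apply: eq_integral => x _; rewrite -ind//.
apply: eq_integral => y _; rewrite /f /= mul0r mul1r add0r !indicE.
by congr ((nat_of_bool _)%:R%:E); apply/idP/idP; rewrite !inE.
Qed.

Lemma gaussian_family_sign (d : measure_display) (T : measurableType d)
    (R : realType) (P : probability T R) (I : finType) (X : I -> T -> R)
    (e : I -> R) : gaussian_family P X -> (forall i, e i ^+ 2 = 1)%R ->
  gaussian_family P (fun i w => e i * X i w)%R.
Proof.
move=> [mX PX] he; split=> [i|B mB].
  by apply: measurable_funM => //; exact: measurable_cst.
pose C i := [set x | B i (e i * x)%R].
have mC i : measurable (C i).
  have mM : measurable_fun setT (fun x : R => e i * x)%R.
    by apply: measurable_funM => //; exact: measurable_cst.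
  by have := mM measurableT _ (mB i); rewrite setTI.
rewrite -[\bigcap_i _]/(\bigcap_i (X i @^-1` C i)) PX//.
apply: eq_bigr => i _; have := he i; move/eqP; rewrite sqrf_eq1 => /orP[]/eqP ei.
  by congr (normal_prob 0 1 _); apply/funext => x; rewrite /C /= ei mul1r.
rewrite -[RHS]normal_prob_opp//.
by congr (normal_prob 0 1 _); apply/funext => x; rewrite /C /= ei mulN1r.
Qed.

Lemma gaussian_family_orthonormal (d : measure_display) (T : measurableType d)
    (R : realType) (P : probability T R) (n m : nat)
    (X : 'I_n * 'I_m -> T -> R) (V : 'M[R]_n) :
  gaussian_family P X -> orthonormal_cols V ->
  gaussian_family P (fun ij w =>
    (V^T *m (\matrix_(i, j) X (i, j) w)) ij.1 ij.2).
Proof.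
move=> gX /orthonormal_givens[G [e [hG he ->]]].
have gY := gaussian_family_givens gX hG.
have gZ := gaussian_family_sign (e := fun ij => e 0%R ij.1) gY (fun ij => he ij.1).
apply: (gaussian_family_ext gZ).
by move=> [i j] w /=; rewrite -mulmxA mul_diag_mx [RHS]mxE.
Qed.

(** * Gaussian moments *)

(** The integrand times the standard density is [u^-1] times the centred normal density of standard
    deviation [u^-1]. *)
Lemma normal_prob_laplace (R : realType) (u : R) : (0 < u)%R ->
  \int[normal_prob 0 1]_x (expR (- (u ^+ 2 - 1) * x ^+ 2 / 2))%:E = (u^-1)%:E.
Proof.
move=> u0; have un0 : u != 0%R by rewrite gt_eqF.
have iun0 : (u^-1 != 0)%R by rewrite invr_eq0.
have mexp : measurable_fun setT (fun x : R => expR (- (u ^+ 2 - 1) * x ^+ 2 / 2)).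
  apply: measurableT_comp => //; apply: measurable_funM => //.
  by apply: measurable_funM => //; exact: measurable_funX.
rewrite ge0_integral_normal_prob//; last exact/measurable_EFinP.
transitivity (\int[lebesgue_measure]_x ((u^-1)%:E * (normal_pdf 0 u^-1 x)%:E)).
  apply: eq_integral => x _; rewrite -!EFinM; congr _%:E.
  rewrite !normal_pdfE ?oner_neq0//.
  have pk : (normal_peak u^-1 = u * normal_peak 1)%R.
    rewrite /normal_peak expr1n mul1r -mulrnAr sqrtrM ?sqr_ge0// sqrtr_sqr.
    by rewrite ger0_norm ?invr_ge0 ?ltW// invfM invrK.
  rewrite pk [RHS]mulrA mulKf// mulrCA; congr (_ * _)%R.
  rewrite /normal_fun -expRD; congr expR; rewrite !subr0 expr1n.
  by field.
rewrite ge0_integralZl//; last 3 first.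
- by apply/measurable_EFinP; exact: measurable_normal_pdf.
- by move=> x _; rewrite lee_fin normal_pdf_ge0.
- by rewrite lee_fin invr_ge0 ltW.
by rewrite integral_normal_pdf mule1.
Qed.

Lemma normal_prob_sqr_le (R : realType) :
  \int[@normal_prob R 0 1]_x (x ^+ 2)%:E <= 6%:E.
Proof.
(* With [u^2 = 1/2] the Laplace integrand is [exp (x^2 / 4)], and [x^2 <= 4 * exp (x^2 / 4)]. The
   resulting bound [4 / u] is at most 6 because [u >= 2/3]. *)
pose u : R := Num.sqrt 2^-1.
have u2 : (u ^+ 2 = 2^-1)%R by rewrite sqr_sqrtr.
have u0 : (0 < u)%R by rewrite sqrtr_gt0.
apply: (@le_trans _ _ (\int[normal_prob 0 1]_x
    (4%:E * (expR (- (u ^+ 2 - 1) * x ^+ 2 / 2))%:E))).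
  apply: ge0_le_integralT => x; first by rewrite lee_fin sqr_ge0.
  rewrite -EFinM lee_fin; apply: le_trans (ler_wpM2l _ (expR_ge1Dx _)) => //.
  by rewrite u2; have := sqr_ge0 x; lra.
rewrite ge0_integralZl//; last first.
  apply/measurable_EFinP; apply: measurableT_comp => //; apply: measurable_funM => //.
  by apply: measurable_funM => //; exact: measurable_funX.
rewrite normal_prob_laplace// -EFinM lee_fin.
have h : (2 / 3 <= u)%R.
  rewrite -(ler_pXn2r (ltn0Sn 1)) ?nnegrE ?ltW// u2; lra.
rewrite ler_pdivrMr//; lra.
Qed.

Lemma gaussian_family_prod (d : measure_display) (T : measurableType d)
    (R : realType) (P : probability T R) (I : finType) (X : I -> T -> R)
    (f : R -> R) (a : R) (S : seq I) : gaussian_family P X ->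
  measurable_fun setT f -> (forall x, 0 <= f x)%R ->
  \int[normal_prob 0 1]_x (f x)%:E = a%:E -> uniq S ->
  \int[P]_w (\prod_(i <- S) f (X i w))%:E = (a ^+ size S)%:E.
Proof.
move=> gX mf f0 fa; elim: S => [_|i S IH /= /andP[iS uS]].
  under eq_integral do rewrite big_nil.
  by rewrite expr0 integral_cst// [X in _ * X]probability_setT mule1.
have P0 w : (0 <= \prod_(j <- S) f (X j w))%R by apply: prodr_ge0.
have mfi (L : pred I) (j : I) : L j -> measurable_fun setT
    ((fun w => f (X j w)) : g_sigma_algebraType (cylinders X L) -> R).
  by move=> Lj; apply: (measurableT_comp mf); exact: measurable_cylinders.
pose J := pred1 i; pose K := [pred j | j \in S].
pose h (z : g_sigma_algebraType (cylinders X J) * g_sigma_algebraType (cylinders X K))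
  : \bar R := (f (X i z.1) * \prod_(j <- S) f (X j z.2))%:E.
have mP : measurable_fun setT ((fun w => \prod_(j <- S) f (X j w))%R
    : g_sigma_algebraType (cylinders X K) -> R).
  by apply: measurable_prod => j jS; exact: mfi.
have mh : measurable_fun setT h.
  apply/measurable_EFinP; apply: measurable_funM.
    by apply: (measurableT_comp (mfi J i (eqxx i))).
  by apply: (measurableT_comp mP).
have h0 z : 0 <= h z by rewrite lee_fin mulr_ge0.
have JK j : ~~ (J j && K j) by apply/negP => /andP[/eqP -> /=]; rewrite (negbTE iS).
have mPT : measurable_fun setT (fun w => \prod_(j <- S) f (X j w))%R.
  by apply: measurable_prod => j _; apply: (measurableT_comp mf); exact: gX.1.
under eq_integral do rewrite big_cons.
rewrite -[LHS]/(\int[P]_w h (w, w)) (gaussian_decouple gX JK mh h0).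
transitivity (\int[P]_w ((f (X i w))%:E * (a ^+ size S)%:E)).
  apply: eq_integral => w _; rewrite /h /=; under eq_integral do rewrite EFinM.
  rewrite ge0_integralZl//.
  - by rewrite IH.
  - exact/measurable_EFinP.
  - by move=> x _; rewrite lee_fin.
  - by rewrite lee_fin.
have a0 : (0 <= a)%R.
  by rewrite -lee_fin -fa; apply: integral_ge0 => x _; rewrite lee_fin.
rewrite ge0_integralZr//; last 3 first.
- by apply/measurable_EFinP; apply: (measurableT_comp mf); exact: gX.1.
- by move=> x _; rewrite lee_fin.
- by rewrite lee_fin exprn_ge0.
rewrite (gaussian_family_integral i (f := fun x => (f x)%:E) gX)//.
  by rewrite fa -EFinM exprS.
exact/measurable_EFinP.
Qed.

Local Close Scope ereal_scope.

(** * Two improper integrals behind the inverse moment *)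

Lemma ge0_integral_FTC_1y (R : realType) (f F : R -> R) (l : R) :
  (forall x : R, 1 <= x -> 0 <= f x) ->
  (forall x : R, 1 <= x -> {for x, continuous f}) ->
  (forall x : R, 1 <= x -> is_derive x (1 : R) F (f x)) ->
  F x @[x --> +oo] --> l ->
  (\int[lebesgue_measure]_(x in `[1%R, +oo[) (f x)%:E = l%:E - (F 1)%:E)%E.
Proof.
move=> f0 cf dF Fl; apply: ge0_continuous_FTC2y => //.
- apply: continuous_in_subspaceT => x; rewrite inE/= in_itv/= andbT; exact: cf.
- by move=> x x1; have := dF x (ltW x1) => ?; apply: ex_derive.
- apply: cvg_at_right_filter; apply: differentiable_continuous.
  by apply/derivable1_diffP; have := dF 1 (lexx 1) => ?; apply: ex_derive.
- move=> x; rewrite in_itv/= andbT => x1; rewrite derive1E.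
  by have := dF x (ltW x1) => ?; apply: derive_val.
Qed.

Lemma integral_expR_sqr_1y (R : realType) (a : R) : 0 < a ->
  (\int[lebesgue_measure]_(u in `[1%R, +oo[)
     (u * expR (- (u ^+ 2 - 1) * a / 2))%:E = (a^-1)%:E)%E.
Proof.
move=> a0; pose g (u : R) := expR (- ((u ^+ 2 - 1) * a / 2)).
pose F (u : R) := - a^-1 * g u.
have dg u : is_derive u (1 : R) g (- (u * a) * g u).
  rewrite /g.
  pose h (u : R) := - ((u ^+ 2 - 1) * a / 2).
  have dh : is_derive u (1 : R) h (- (u * a)).
    by rewrite /h; apply: is_derive_eq; rewrite /GRing.scale/=; field.
  have := is_derive1_comp (is_derive_expR (h u)) dh.
  by rewrite mulrC.
have -> : (fun u : R => (u * expR (- (u ^+ 2 - 1) * a / 2))%:E) =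
    (fun u => (u * g u)%:E).
  by apply/funext => u; rewrite /g !mulNr.
have dF u : is_derive u (1 : R) F (u * g u).
  rewrite /F; have := dg u => ?; apply: is_derive_eq.
  by rewrite /GRing.scale/=; field; rewrite gt_eqF.
rewrite (@ge0_integral_FTC_1y _ _ F 0).
- rewrite /F /g expr1n subrr mul0r mul0r oppr0 expR0 mulr1.
  by rewrite -EFinB opprK add0r.
- by move=> x x1; rewrite mulr_ge0 ?expR_ge0// (le_trans ler01).
- move=> x _; apply: continuousM => //; apply: differentiable_continuous.
  by apply/derivable1_diffP; have := dg x => ?; apply: ex_derive.
- rewrite -(mulr0 (- a^-1)); apply: cvgMl_tmp.
  apply: (cvg_comp (fun u : R => (u ^+ 2 - 1) * a / 2) (fun x => expR (- x)));
    last exact: cvgr_expR.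
  apply/cvgryPge => A; near=> u.
  have u1 : 1 <= u by near: u; exact: nbhs_pinfty_ge.
  have uA : 1 + 2 * A / a <= u by near: u; apply: nbhs_pinfty_ge; rewrite num_real.
  have uA' : 2 * A <= (u - 1) * a by rewrite -ler_pdivrMr// lerBrDl.
  have : (u - 1) * a <= (u ^+ 2 - 1) * a by apply: ler_wpM2r; [exact: ltW|nra].
  lra.
Unshelve. all: by end_near. Qed.

(** Each of [n.+3] independent Gaussian coordinates contributes a factor [u^-1]; the extra factor
    [u] comes from [integral_expR_sqr_1y]. *)
Lemma integral_exprV_1y (R : realType) (n : nat) :
  (\int[lebesgue_measure]_(u in `[1%R, +oo[)
     (u * u^-1 ^+ n.+3)%:E = (n.+1%:R^-1 : R)%:E)%E.
Proof.
pose F (u : R) := - n.+1%:R^-1 * u^-1 ^+ n.+1.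
have dV (u : R) : 1 <= u -> is_derive u (1 : R) (fun x : R => x^-1) (- u ^- 2).
  move=> u1; have un0 : u != 0 by rewrite gt_eqF// (lt_le_trans ltr01).
  have := @is_deriveV R id u 1 1 un0 _ => h; apply: is_derive_eq.
  by rewrite /GRing.scale/= mulr1.
have dF (u : R) : 1 <= u -> is_derive u (1 : R) F (u * u^-1 ^+ n.+3).
  move=> u1; have un0 : u != 0 by rewrite gt_eqF// (lt_le_trans ltr01).
  have := is_deriveZ (- n.+1%:R^-1) (is_deriveX n.+1 (dV u u1)).
  have -> : - n.+1%:R^-1 \*: ((fun x : R => x^-1) ^+ n.+1) = F.
    by apply/funext => x; rewrite /F /= exprfctE.
  move=> h; apply: is_derive_eq; rewrite /GRing.scale/=.
  have : n.+1%:R != 0 :> R by rewrite pnatr_eq0.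
  rewrite !exprS /=; move: (n.+1%:R : R) => c cn0; field.
  by rewrite un0 cn0.
rewrite (@ge0_integral_FTC_1y _ _ F 0).
- rewrite /F invr1 expr1n mulr1.
  by rewrite -EFinB opprK add0r.
- move=> x x1; have x0 : 0 <= x by rewrite (le_trans ler01).
  by rewrite mulr_ge0// exprn_ge0// invr_ge0.
- move=> x x1; have := dV x x1 => ?.
  have ci : {for x, continuous (fun u : R => u^-1)}.
    by apply: differentiable_continuous; apply/derivable1_diffP; apply: ex_derive.
  have cX : {for x^-1, continuous (fun y : R => y ^+ n.+3)} by exact: exprn_continuous.
  by apply: continuousM; [exact: cvg_id|exact: (continuous_comp ci cX)].
- rewrite -(mulr0 (- n.+1%:R^-1)); apply: cvgMl_tmp.
  have inv0 : (fun u : R => u^-1) x @[x --> +oo] --> 0.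
    by apply/gtr0_cvgV0; [exact: nbhs_pinfty_gt|exact: cvg_id].
  have -> : (0 : R) = 0 ^+ n.+1 by rewrite expr0n.
  apply: (cvg_comp (fun u : R => u^-1) (fun x => x ^+ n.+1) inv0).
  exact: exprn_continuous.
Qed.

Local Open Scope ereal_scope.

(** * Moments of a Gaussian vector against fixed data *)

Lemma gaussian_family_givens_col (d : measure_display) (T : measurableType d)
    (R : realType) (P : probability T R) (l : nat) (g : 'I_l -> T -> R)
    (O : 'M[R]_l) : gaussian_family P g -> givens_prod O ->
  gaussian_family P (fun c w => (O *m \col_a g a w) c 0%R).
Proof.
move=> gg hO.
have gX : gaussian_family P (fun ij : 'I_l * 'I_1 => g ij.1).
  by apply: (gaussian_family_sub gg) => -[a b] [c e] /= ->; rewrite (ord1 b) (ord1 e).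
have gY := gaussian_family_givens gX hO.
have inj : injective (fun c : 'I_l => (c, 0%R : 'I_1)) by move=> a b [].
apply: (gaussian_family_ext (gaussian_family_sub gY inj)) => c w /=.
by congr ((_ *m _) _ _); apply/matrixP => a b; rewrite !mxE.
Qed.

(** Rotate [x] onto the first axis: the linear form becomes [t] times one standard Gaussian
    variable, with [t ^+ 2 = nsq x]. Without a first axis, at [l = 0], the sum is empty. *)
Lemma gaussian_linear_sqr_le (d : measure_display) (T : measurableType d)
    (R : realType) (P : probability T R) (l : nat) (g : 'I_l -> T -> R)
    (x : 'cV[R]_l) : gaussian_family P g ->
  \int[P]_w ((\sum_c g c w * x c 0) ^+ 2)%:E <= (6 * nsq x)%:E.
Proof.
case: l g x => [|l] g x gg.
  rewrite (eq_integral (fun=> 0)) ?integral0 ?lee_fin ?mulr_ge0 ?nsq_ge0//.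
  by move=> w _; rewrite big_ord0 expr0n.
have [Q hQ Qx] := givens_triangularize x.
have hQo := givens_prod_orthonormal hQ.
have gY := gaussian_family_givens_col gg hQ.
set y := (Q *m x)%R; pose t : R := y 0%R 0%R.
have yE : y = (t *: delta_mx 0 0)%R.
  apply/matrixP => i j; rewrite !ord1 [RHS]mxE [delta_mx _ _ _ _]mxE eqxx andbT.
  have [->|i0] := eqVneq i 0%R; first by rewrite mulr1.
  by rewrite mulr0 Qx// lt0n.
have sumE w : (\sum_c g c w * x c 0 = (Q *m \col_a g a w) 0 0 * t)%R.
  transitivity (fdot (\col_a g a w) x).
    by rewrite fdotE; apply: eq_bigr => c _; rewrite big_ord1 mxE.
  rewrite -[x in LHS]mul1mx -hQo -mulmxA -/y fdot_mull trmxK yE fdotZr mulrC.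
  congr (_ * _)%R; rewrite fdotE; under eq_bigr do rewrite big_ord1.
  rewrite (bigD1 0%R)//= big1 ?addr0; first by rewrite [delta_mx _ _ _ _]mxE eqxx mulr1.
  by move=> i /negbTE i0; rewrite [delta_mx _ _ _ _]mxE i0 mulr0.
have nx : nsq x = (t ^+ 2)%R.
  rewrite -(nsq_mull x hQo) -/y yE nsqZ -[delta_mx _ _]mul1mx -colE.
  by rewrite nsq_col_orthonormal ?mulr1// /orthonormal_cols trmx1 mulmx1.
under eq_integral do rewrite sumE exprMn EFinM muleC.
have msq : measurable_fun setT (fun r : R => (r ^+ 2)%:E).
  by apply/measurable_EFinP; exact: measurable_funX.
have sq0 (r : R) : 0 <= (r ^+ 2)%:E by rewrite lee_fin sqr_ge0.
rewrite ge0_integralZl//.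
- rewrite (gaussian_family_integral 0%R gY msq sq0) nx muleC (EFinM 6).
  by apply: lee_wpmul2r => //; exact: normal_prob_sqr_le.
- by apply: (measurableT_comp msq); exact: gY.1.
Qed.

(* Added to the error bound so that it holds pointwise, also where the dual
   vector does not exist and [0^-1 = 0] would give a junk value. *)
Definition zero_penalty (R : realType) (x : R) : \bar R :=
  if x == 0%R then +oo else 0.

Lemma zero_penalty_ge0 (R : realType) (x : R) : 0 <= zero_penalty x.
Proof. by rewrite /zero_penalty; case: ifP; rewrite ?leey. Qed.

Lemma zero_penaltyE (R : realType) :
  @zero_penalty R = ((fun=> +oo) \_ [set 0%R]).
Proof.
apply/funext => x; rewrite patchE /zero_penalty; congr (if _ then _ else _).
by apply/eqP/idP; rewrite inE.
Qed.

Lemma measurable_zero_penalty (R : realType) :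
  measurable_fun setT (@zero_penalty R).
Proof.
rewrite zero_penaltyE; apply/(measurable_restrictT _ _).1 => //.
Qed.

(** By [gs_proj_lower], a vanishing residual forces a rotated Gaussian coordinate to vanish, which
    is a null event. *)
Lemma gaussian_gs_proj_null (d : measure_display) (T : measurableType d)
    (R : realType) (P : probability T R) (l : nat) (g : 'I_l -> T -> R)
    (gs : seq 'cV[R]_l) : gaussian_family P g -> (size gs < l)%N ->
  \int[P]_w zero_penalty (nsq (gs_proj gs *m \col_a g a w)) = 0.
Proof.
move=> gg sl; have [Q hQ Qle] := gs_proj_lower gs.
have gY := gaussian_family_givens_col gg hQ.
pose c := Ordinal sl; set Y := (X in gaussian_family P X) in gY.
apply/eqP; rewrite eq_le integral_ge0 ?andbT; last first.
  by move=> w _; exact: zero_penalty_ge0.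
apply: (@le_trans _ _ (\int[P]_w zero_penalty (Y c w))).
  apply: ge0_le_integralT => w; first exact: zero_penalty_ge0.
  rewrite {1}/zero_penalty; case: ifP => [/eqP n0|_]; last exact: zero_penalty_ge0.
  rewrite /zero_penalty; case: ifPn => // /negP; case; rewrite -sqrf_eq0.
  rewrite eq_le sqr_ge0 andbT -n0; apply: le_trans (Qle _).
  by rewrite (bigD1 c)//= lerDl sumr_ge0// => i _; exact: sqr_ge0.
rewrite (gaussian_family_integral c gY (@measurable_zero_penalty R));
  last exact: zero_penalty_ge0.
rewrite zero_penaltyE -integral_mkcond null_set_integral//.
exact: ((null_content_dominatesP _ _).1 (@normal_prob_dominates R 0 1) _
  (measurable_set1 _) (lebesgue_measure_set1 _)).
Qed.

Lemma gaussian_gs_proj_inv (d : measure_display) (T : measurableType d)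
    (R : realType) (P : probability T R) (l n : nat) (g : 'I_l -> T -> R)
    (gs : seq 'cV[R]_l) : gaussian_family P g -> (size gs + n.+3)%N = l ->
  \int[P]_w ((nsq (gs_proj gs *m \col_a g a w))^-1)%:E <= (n.+1%:R^-1)%:E.
Proof.
move=> gg sl; have [Q hQ Qle] := gs_proj_lower gs.
have gY := gaussian_family_givens_col gg hQ.
pose Y (c : 'I_l) (w : T) := (Q *m \col_a g a w) c 0%R.
have mY c : measurable_fun setT (Y c) := gY.1 c.
pose S := enum [pred c : 'I_l | (size gs <= c)%N].
have uS : uniq S := enum_uniq _.
have sS : size S = n.+3.
  rewrite -cardE -sum1_card /=.
  have := sum1_card (mem 'I_l); rewrite card_ord.
  rewrite (bigID (fun c : 'I_l => (size gs <= c)%N))/=.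
  rewrite [X in (_ + X)%N](eq_bigl (fun c : 'I_l => (c < size gs)%N)); last first.
    by move=> c; rewrite -ltnNge.
  have sgl : (size gs <= l)%N by rewrite -[leqRHS]sl leq_addr.
  rewrite -(big_ord_widen l (fun=> 1%N) sgl) [X in (_ + X)%N]sum1_card card_ord => E.
  by apply/eqP; rewrite -(eqn_add2r (size gs)) addnC [X in _ == X]addnC sl addnC E.
pose D : set R := `[1%R, +oo[%classic.
have mD : measurable D by exact: measurable_itv.
pose e (u x : R) := expR (- (u ^+ 2 - 1) * x ^+ 2 / 2).
have e0 u x : (0 <= e u x)%R by exact: expR_ge0.
(* The domain [u >= 1] is put into the integrand as an indicator, so that Tonelli applies over the
   whole line. *)
pose phi (z : R * T) : \bar R := (\1_D z.1 * (z.1 * \prod_(c <- S) e z.1 (Y c z.2)))%:E.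
have mphi : measurable_fun setT phi.
  apply/measurable_EFinP; apply: measurable_funM.
    have mi : measurable_fun setT (\1_D : R -> R) by exact: measurable_indic.
    exact: (measurableT_comp mi).
  apply: measurable_funM => //; apply: measurable_prod => c _.
  apply: measurableT_comp => //; apply: measurable_funM => //.
  apply: measurable_funM.
    apply: measurableT_comp => //; apply: measurable_funB => //.
    exact: measurable_funX.
  by apply: measurable_funX; exact: (measurableT_comp (mY c)).
have D1 u : u \in D = (1 <= u)%R by apply/idP/idP; rewrite inE /D/= in_itv/= andbT.
have phi0 z : 0 <= phi z.
  rewrite lee_fin /phi indicE D1; case: (leP 1%R z.1) => [u1|_]; last by rewrite /= mulr0n mul0r.
  rewrite /= mulr1n mul1r; apply: mulr_ge0; first exact: le_trans u1.
  exact: prodr_ge0.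
apply: (@le_trans _ _ (\int[P]_w \int[lebesgue_measure]_u phi (u, w))).
  apply: ge0_le_integralT => w; first by rewrite lee_fin invr_ge0 nsq_ge0.
  (* Where the residual vanishes, [0^-1 = 0] makes the inequality trivial; that this happens with
     probability zero is the business of [zero_penalty]. *)
  set a := nsq _; have [a0|a0] := eqVneq a 0%R.
    by rewrite a0 invr0; apply: integral_ge0.
  have agt0 : (0 < a)%R by rewrite lt_neqAle eq_sym a0 nsq_ge0.
  rewrite -(integral_expR_sqr_1y agt0) integral_mkcond.
  apply: ge0_le_integralT => u.
    rewrite patchE; case: ifP => //; rewrite D1 => u1.
    by rewrite lee_fin mulr_ge0 ?expR_ge0// (le_trans ler01).
  rewrite patchE /phi /= indicE D1; case: (leP 1%R u) => [u1|_]; last by rewrite /= mulr0n mul0r.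
  rewrite /= mulr1n mul1r lee_fin; apply: ler_wpM2l; first exact: le_trans u1.
  rewrite /e -(big_morph expR (@expRD R) (@expR0 R)) ler_expR.
  rewrite -mulr_suml -mulr_sumr; apply: ler_wpM2r => //.
  rewrite !mulNr lerN2; apply: ler_wpM2l.
    by rewrite subr_ge0 -[1%R](expr1n _ 2) lerXn2r// nnegrE (le_trans ler01).
  by apply: le_trans (Qle _); rewrite /S big_enum.
rewrite -[leLHS](@fubini_tonelli _ _ _ _ R lebesgue_measure P phi mphi phi0).
rewrite -(integral_exprV_1y R n) [leRHS]integral_mkcond.
apply: ge0_le_integralT => u; first by apply: integral_ge0.
rewrite patchE /phi /= indicE D1; case: (leP 1%R u) => [u1|_]; last first.
  by rewrite integral0_eq// => w _; rewrite /= mulr0n mul0r.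
have u0 : (0 < u)%R by exact: lt_le_trans u1.
under eq_integral do rewrite /= mulr1n mul1r EFinM.
have me : measurable_fun setT (e u).
  apply: measurableT_comp => //; apply: measurable_funM => //.
  by apply: measurable_funM => //; exact: measurable_funX.
rewrite ge0_integralZl//; last 3 first.
- apply/measurable_EFinP; apply: measurable_prod => c _.
  exact: (measurableT_comp me (mY c)).
- by move=> w _; rewrite lee_fin prodr_ge0.
- by rewrite lee_fin ltW.
by rewrite (gaussian_family_prod gY me (e0 u) (normal_prob_laplace u0) uS) sS.
Qed.

(** * Rows of a Gaussian matrix *)

Local Close Scope ereal_scope.

Definition measurable_mx (d : measure_display) (T : measurableType d)
    (R : realType) (m n : nat) (A : T -> 'M[R]_(m, n)) : Prop :=
  forall i j, measurable_fun setT (fun t => A t i j).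

Lemma measurable_mx_cst (d : measure_display) (T : measurableType d)
    (R : realType) (m n : nat) (A : 'M[R]_(m, n)) : measurable_mx (fun _ : T => A).
Proof. by move=> i j; exact: measurable_cst. Qed.

Lemma measurable_mx_sub (d : measure_display) (T : measurableType d)
    (R : realType) (m n : nat) (A B : T -> 'M[R]_(m, n)) :
  measurable_mx A -> measurable_mx B -> measurable_mx (fun t => A t - B t).
Proof.
move=> mA mB i j; under eq_fun do rewrite mxE [X in _ + X]mxE.
by apply: measurable_funB; [exact: mA|exact: mB].
Qed.

Lemma measurable_mx_scale (d : measure_display) (T : measurableType d)
    (R : realType) (m n : nat) (a : T -> R) (A : T -> 'M[R]_(m, n)) :
  measurable_fun setT a -> measurable_mx A -> measurable_mx (fun t => a t *: A t).
Proof.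
by move=> ma mA i j; under eq_fun do rewrite mxE; apply: measurable_funM => //; exact: mA.
Qed.

Lemma measurable_mx_tr (d : measure_display) (T : measurableType d)
    (R : realType) (m n : nat) (A : T -> 'M[R]_(m, n)) :
  measurable_mx A -> measurable_mx (fun t => (A t)^T).
Proof. by move=> mA i j; under eq_fun do rewrite mxE; exact: mA. Qed.

Lemma measurable_mx_mul (d : measure_display) (T : measurableType d)
    (R : realType) (m n r : nat) (A : T -> 'M[R]_(m, n)) (B : T -> 'M[R]_(n, r)) :
  measurable_mx A -> measurable_mx B -> measurable_mx (fun t => A t *m B t).
Proof.
move=> mA mB i j; under eq_fun do rewrite mxE.
apply: measurable_sum => a.
by apply: measurable_funM; [exact: mA|exact: mB].
Qed.

Lemma measurable_nsq (d : measure_display) (T : measurableType d)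
    (R : realType) (m n : nat) (A : T -> 'M[R]_(m, n)) :
  measurable_mx A -> measurable_fun setT (fun t => nsq (A t)).
Proof.
move=> mA; under eq_fun do rewrite nsqE.
apply: measurable_sum => i; apply: measurable_sum => j.
by apply: measurable_funX; exact: mA.
Qed.

Lemma measurable_invr (R : realType) : measurable_fun setT (fun x : R => x^-1).
Proof.
(* The inverse is [x * (x ^+ 2)^-1], so the power is taken of a nonnegative number, and both sides
   are 0 at [x = 0]. *)
rewrite (_ : (fun x => _) = (fun x => x * (@powR R ^~ (-1) \o (fun y => y ^+ 2)) x)).
  apply: measurable_funM => //; apply: measurableT_comp; first exact: measurable_powR.
  exact: measurable_funX.
apply/funext => x; rewrite /= powR_inv1 ?sqr_ge0//.
by have [->|x0] := eqVneq x 0; [rewrite mul0r invr0|field].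
Qed.

Lemma measurable_gs_proj (d : measure_display) (T : measurableType d)
    (R : realType) (l : nat) (I : eqType) (h : I -> T -> 'cV[R]_l) (s : seq I) :
  (forall a, a \in s -> measurable_mx (h a)) ->
  measurable_mx (fun t => gs_proj [seq h a t | a <- s]).
Proof.
elim: s => [_|a s IH hs] /=; first exact: measurable_mx_cst.
have mP : measurable_mx (fun t => gs_proj [seq h a t | a <- s]).
  by apply: IH => b bs; apply: hs; rewrite inE bs orbT.
have mu : measurable_mx (fun t => gs_proj [seq h a t | a <- s] *m h a t).
  by apply: measurable_mx_mul => //; apply: hs; rewrite mem_head.
apply: measurable_mx_sub => //; apply: measurable_mx_scale.
  by apply: (measurableT_comp (@measurable_invr R)); exact: measurable_nsq.
by apply: measurable_mx_mul => //; exact: measurable_mx_tr.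
Qed.

Definition rowvec (T : Type) (R : realType) (n l : nat)
    (X : 'I_n * 'I_l -> T -> R) (a : 'I_n) (w : T) : 'cV[R]_l :=
  \col_c X (a, c) w.

Definition other_rows (T : Type) (R : realType) (n l N : nat)
    (X : 'I_n * 'I_l -> T -> R) (j : 'I_n) (w : T) : seq 'cV[R]_l :=
  [seq rowvec X a w | a <- enum [pred a : 'I_n | (a < N)%N && (a != j)]].

Definition residual_row (T : Type) (R : realType) (n l N : nat)
    (X : 'I_n * 'I_l -> T -> R) (j : 'I_n) (w : T) : 'cV[R]_l :=
  gs_proj (other_rows N X j w) *m rowvec X j w.

Definition dual_row (T : Type) (R : realType) (n l N : nat)
    (X : 'I_n * 'I_l -> T -> R) (j : 'I_n) (w : T) : 'cV[R]_l :=
  gs_dual (other_rows N X j w) (rowvec X j w).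

Lemma size_other_rows (T : Type) (R : realType) (n l N : nat)
    (X : 'I_n * 'I_l -> T -> R) (j : 'I_n) (w : T) :
  (j < N)%N -> (N < n)%N -> size (other_rows N X j w) = N.-1.
Proof.
move=> jN Nn; rewrite size_map -cardE.
have := cardD1 j [pred a : 'I_n | (a < N)%N]; rewrite inE jN.
have -> : #|[pred a : 'I_n | (a < N)%N]| = N.
  rewrite -sum1_card /= -(big_ord_widen n (fun=> 1%N) (ltnW Nn)).
  by rewrite sum1_card card_ord.
move=> E; rewrite [in RHS]E add1n /=.
by apply: eq_card => a; rewrite !inE andbC.
Qed.

Lemma measurable_rowvec (d : measure_display) (T : measurableType d)
    (R : realType) (n l : nat) (X : 'I_n * 'I_l -> T -> R) (a : 'I_n) :
  (forall c, measurable_fun setT (X (a, c))) -> measurable_mx (rowvec X a).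
Proof. by move=> mX c e; under eq_fun do rewrite mxE; exact: mX. Qed.

Lemma measurable_other_proj (d : measure_display) (T : measurableType d)
    (R : realType) (n l N : nat) (X : 'I_n * 'I_l -> T -> R) (j : 'I_n) :
  (forall (a : 'I_n) c, (a < N)%N -> a != j -> measurable_fun setT (X (a, c))) ->
  measurable_mx (fun w => gs_proj (other_rows N X j w)).
Proof.
move=> mX; apply: measurable_gs_proj => a; rewrite mem_enum inE => /andP[aN aj].
by apply: measurable_rowvec => c; exact: mX.
Qed.

Local Open Scope ereal_scope.

(* Conditioning on the other rows: [F] sees the residual of a fixed projector
   applied to a Gaussian row. *)
Lemma gaussian_residual_decouple (d : measure_display) (T : measurableType d)
    (R : realType) (P : probability T R) (n l N : nat)
    (X : 'I_n * 'I_l -> T -> R) (j : 'I_n) (F : R -> \bar R) (b : R) :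
  gaussian_family P X -> (0 <= b)%R ->
  measurable_fun setT F -> (forall x, 0 <= F x) ->
  (forall w1, \int[P]_w2 F (nsq (gs_proj (other_rows N X j w1) *m rowvec X j w2))
     <= b%:E) ->
  \int[P]_w F (nsq (residual_row N X j w)) <= b%:E.
Proof.
move=> gX b0 mF F0 hF.
pose J := [pred ac : 'I_n * 'I_l | (ac.1 < N)%N && (ac.1 != j)].
pose K := [pred ac : 'I_n * 'I_l | ac.1 == j].
pose f (z : g_sigma_algebraType (cylinders X J) * g_sigma_algebraType (cylinders X K))
  : \bar R := F (nsq (gs_proj (other_rows N X j z.1) *m rowvec X j z.2)).
have mf : measurable_fun setT f.
  apply: (measurableT_comp mF); apply: measurable_nsq.
  apply: measurable_mx_mul => u v.
    have hJ (a : 'I_n) c : (a < N)%N -> a != j ->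
        measurable_fun setT (X (a, c) : g_sigma_algebraType (cylinders X J) -> R).
      by move=> aN aj; apply: measurable_cylinders; rewrite /J /= aN.
    exact: (measurableT_comp (measurable_other_proj hJ u v)).
  have h := @measurable_rowvec _ (g_sigma_algebraType (cylinders X K)) _ _ _ X j
    (fun c => @measurable_cylinders _ _ _ _ X K (j, c) (eqxx j)).
  exact: (measurableT_comp (h u v)).
have f0 z : 0 <= f z by exact: F0.
have JK i : ~~ (J i && K i).
  by apply/negP => /andP[/andP[_ ij] /eqP ij']; rewrite ij' eqxx in ij.
rewrite -[leLHS]/(\int[P]_w f (w, w)) (gaussian_decouple gX JK mf f0).
apply: (@le_trans _ _ (\int[P]_w b%:E)).
  apply: ge0_le_integralT => w1; first by apply: integral_ge0.
  exact: hF.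
by rewrite integral_cst// [X in _ * X]probability_setT mule1.
Qed.

Lemma gaussian_family_row (d : measure_display) (T : measurableType d)
    (R : realType) (P : probability T R) (n l : nat)
    (X : 'I_n * 'I_l -> T -> R) (j : 'I_n) :
  gaussian_family P X -> gaussian_family P (fun c => X (j, c)).
Proof. by move=> gX; apply: (gaussian_family_sub gX) => a b []. Qed.

Lemma gaussian_residual_inv (d : measure_display) (T : measurableType d)
    (R : realType) (P : probability T R) (n l N r : nat)
    (X : 'I_n * 'I_l -> T -> R) (j : 'I_n) :
  gaussian_family P X -> (j < N)%N -> (N < n)%N -> (N.-1 + r.+3)%N = l ->
  \int[P]_w ((nsq (residual_row N X j w))^-1)%:E <= (r.+1%:R^-1)%:E.
Proof.
move=> gX jN Nn Nl.
(* The decoupling lemma asks for a function that is nonnegative on all of [R]; the absolute value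
   changes nothing at squared norms. *)
have normV (u : 'cV[R]_l) : `|(nsq u)^-1|%R = ((nsq u)^-1)%R.
  by rewrite ger0_norm// invr_ge0 nsq_ge0.
under eq_integral do rewrite -normV.
apply: (gaussian_residual_decouple (F := fun x => `|x^-1|%:E) gX) => //.
- apply/measurable_EFinP; apply: measurableT_comp => //; exact: measurable_invr.
- move=> w1; under eq_integral do rewrite normV.
  apply: (gaussian_gs_proj_inv (gaussian_family_row j gX)).
  by rewrite size_other_rows.
Qed.

Lemma gaussian_residual_null (d : measure_display) (T : measurableType d)
    (R : realType) (P : probability T R) (n l N : nat)
    (X : 'I_n * 'I_l -> T -> R) (j : 'I_n) :
  gaussian_family P X -> (j < N)%N -> (N < n)%N -> (N <= l)%N ->
  \int[P]_w zero_penalty (nsq (residual_row N X j w)) = 0.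
Proof.
move=> gX jN Nn Nl.
apply/eqP; rewrite eq_le integral_ge0 ?andbT; last first.
  by move=> w _; exact: zero_penalty_ge0.
apply: (gaussian_residual_decouple gX) => //.
- exact: measurable_zero_penalty.
- exact: zero_penalty_ge0.
move=> w1; rewrite (gaussian_gs_proj_null (gaussian_family_row j gX))//.
by rewrite size_other_rows// prednK// (leq_trans _ jN).
Qed.

Lemma gaussian_tail_sqr (d : measure_display) (T : measurableType d)
    (R : realType) (P : probability T R) (n l N r : nat)
    (X : 'I_n * 'I_l -> T -> R) (i j : 'I_n) :
  gaussian_family P X -> (j < N)%N -> (N <= i)%N -> (N.-1 + r.+3)%N = l ->
  \int[P]_w ((\sum_c X (i, c) w * dual_row N X j w c 0) ^+ 2)%:E <=
  (6 / r.+1%:R)%:E.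
Proof.
move=> gX jN Ni Nl; have Nn : (N < n)%N := leq_ltn_trans Ni (ltn_ord i).
pose J := [pred ac : 'I_n * 'I_l | (ac.1 < N)%N].
pose K := [pred ac : 'I_n * 'I_l | ac.1 == i].
pose f (z : g_sigma_algebraType (cylinders X J) * g_sigma_algebraType (cylinders X K))
  : \bar R := ((\sum_c X (i, c) z.2 * dual_row N X j z.1 c 0) ^+ 2)%:E.
have hJ (a : 'I_n) c : (a < N)%N ->
    measurable_fun setT (X (a, c) : g_sigma_algebraType (cylinders X J) -> R).
  by move=> aN; exact: measurable_cylinders.
(* Stated for any measurable space because it serves twice: for the sigma-algebra of the first [N]
   rows, and for the original one. *)
have mres (d' : measure_display) (T' : measurableType d') (Y : 'I_n * 'I_l -> T' -> R) :
    (forall (a : 'I_n) c, (a < N)%N -> measurable_fun setT (Y (a, c))) ->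
    measurable_mx (residual_row N Y j).
  move=> hY; apply: measurable_mx_mul.
    by apply: measurable_other_proj => a c aN _; exact: hY.
  by apply: measurable_rowvec => c; exact: hY.
have mf : measurable_fun setT f.
  apply/measurable_EFinP; apply: measurable_funX; apply: measurable_sum => c.
  apply: measurable_funM.
    exact: (measurableT_comp (@measurable_cylinders _ _ _ _ X K (i, c) (eqxx i))).
  have mr := mres _ (g_sigma_algebraType (cylinders X J)) X hJ.
  have md : measurable_mx (dual_row N X j
      : g_sigma_algebraType (cylinders X J) -> 'cV[R]_l).
    apply: measurable_mx_scale => //.
    by apply: (measurableT_comp (@measurable_invr R)); exact: measurable_nsq.
  exact: (measurableT_comp (md c 0%R)).
have f0 z : 0 <= f z by rewrite lee_fin sqr_ge0.
have JK ac : ~~ (J ac && K ac).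
  by apply/negP => /andP[/= aN /eqP ai]; rewrite ai ltnNge Ni in aN.
rewrite -[leLHS]/(\int[P]_w f (w, w)) (gaussian_decouple gX JK mf f0).
apply: (@le_trans _ _ (\int[P]_w (6%:E * ((nsq (residual_row N X j w))^-1)%:E))).
  apply: ge0_le_integralT => w1; first by apply: integral_ge0.
  rewrite -EFinM -nsq_gs_dual.
  exact: (gaussian_linear_sqr_le (dual_row N X j w1) (gaussian_family_row i gX)).
rewrite ge0_integralZl//.
- by rewrite EFinM; apply: lee_wpmul2l => //; exact: gaussian_residual_inv.
- apply/measurable_EFinP; apply: (measurableT_comp (@measurable_invr R)).
  by apply: measurable_nsq; apply: mres => a c _; exact: gX.1.
- by move=> w _; rewrite lee_fin invr_ge0 nsq_ge0.
Qed.

(** * The expected error *)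

Local Close Scope ereal_scope.

Lemma mxnorm_ge0 (R : realType) (rho : norm_kind) (m n : nat) (A : 'M[R]_(m, n)) :
  0 <= mxnorm rho A.
Proof.
case: rho => /=; last by rewrite frobenius_normE sqrtr_ge0.
apply: le_trans (@frobenius_le_spectral _ _ _ A 0 _); first exact: sqrtr_ge0.
by rewrite /nsq /fdot mulmx0 mxtrace0 ler01.
Qed.

Lemma dual_row_biorthogonal (T : Type) (R : realType) (n l N : nat)
    (X : 'I_n * 'I_l -> T -> R) (i j : 'I_n) (w : T) : (i < N)%N ->
  nsq (residual_row N X j w) != 0 ->
  \sum_c X (i, c) w * dual_row N X j w c 0 = (i == j)%:R.
Proof.
move=> iN res0.
transitivity (((rowvec X i w)^T *m dual_row N X j w) 0 0).
  by rewrite [RHS]mxE; apply: eq_bigr => c _; rewrite !mxE.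
have [->|ij] := eqVneq i j; first by rewrite gs_dual_self// mxE eqxx.
rewrite gs_dual_ortho ?mxE//.
by apply: map_f; rewrite mem_enum inE iN.
Qed.

Lemma standard_gaussian_family (R : realType) (d : measure_display)
    (T : measurableType d) (P : probability T R) (n l : nat)
    (Omega : 'I_n -> 'I_l -> {RV P >-> R}) : standard_gaussian_mx Omega ->
  gaussian_family P (fun ij : 'I_n * 'I_l => Omega ij.1 ij.2 : T -> R).
Proof.
move=> [ind law]; split=> [ij|B mB]; first exact: measurable_funP.
have := ind [set: 'I_n * 'I_l]%SET B mB.
rewrite (_ : [set` [set: 'I_n * 'I_l]%SET] = setT); last first.
  by apply/seteqP; split=> x //= _; rewrite finset.in_setT.
move=> ->; apply: eq_big => [ij|ij _]; first by rewrite finset.in_setT.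
exact: (law ij.1 ij.2 (B ij) (mB ij)).
Qed.

Lemma sum_ord_lt_const (R : realType) (n k : nat) (b : R) : (k <= n)%N ->
  \sum_(j < n | (j < k)%N) b = b * k%:R.
Proof.
by move=> kn; rewrite -(big_ord_widen n (fun=> b) kn) sumr_const card_ord mulr_natr.
Qed.

Lemma sum_ord_ge_const (R : realType) (n N : nat) (b : R) : (N <= n)%N ->
  \sum_(i < n | (N <= i)%N) b = b * (n - N)%:R.
Proof.
move=> Nn; have : \sum_(i < n) b = b * n%:R.
  by rewrite sumr_const card_ord mulr_natr.
rewrite (bigID (fun i : 'I_n => (i < N)%N))/= sum_ord_lt_const//.
under [X in _ + X = _]eq_bigl do rewrite -leqNgt.
by rewrite natrB// mulrBr => <-; rewrite addrAC subrr add0r.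
Qed.

Local Open Scope ereal_scope.

(** The parameter [lam] stands for a bound on the root mean square of [Z]. It is the weight in
    AM-GM, and inserting the bound [lam ^+ 2] for the mean of [Z^2] turns the affine bound back into
    [C1 + C2 * lam]. *)
Lemma expectation_error_le (R : realType) (d : measure_display)
    (T : measurableType d) (P : probability T R) (m n k l N r q : nat)
    (A : 'M[R]_(m, n)) (U : 'M[R]_(m, n)) (s : n.-tuple R) (V : 'M[R]_n)
    (Omega : 'I_n -> 'I_l -> {RV P >-> R}) (rho : norm_kind)
    (Ahat : T -> 'M[R]_(m, n)) (sigma gamma lam : R) :
  is_svd A U s V -> (1 <= k <= N)%N -> (N < n)%N -> (N.-1 + r.+3)%N = l ->
  (0 < singval s k)%R -> standard_gaussian_mx Omega ->
  (forall w, sor_svd_power k q A (sample_mx Omega w) (Ahat w)) ->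
  sigma = singval s N.+1 -> gamma = (sigma / singval s k)%R ->
  (0 < lam)%R -> (6 / r.+1%:R * (n - N)%:R * k%:R <= lam ^+ 2)%R ->
  'E_P[fun w => mxnorm rho (A - Ahat w)] <=
  (mxnorm rho (A - svd_trunc k U s V) +
     (1 + gamma) * sigma * gamma ^+ (2 * q) * lam)%:E.
Proof.
move=> svdA hkN Nn Nl sk0 gO hAhat sigmaE gammaE lam0 hlam.
have [hU hV ss s0 _] := svdA; have [k1 kN] := andP hkN.
have kn : (k <= n)%N := ltnW (leq_ltn_trans kN Nn).
pose X (ij : 'I_n * 'I_l) (w : T) : R := (V^T *m sample_mx Omega w) ij.1 ij.2.
have gX : gaussian_family P X := gaussian_family_orthonormal (standard_gaussian_family gO) hV.
pose z (i j : 'I_n) (w : T) := (\sum_c X (i, c) w * dual_row N X j w c 0)%R.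
pose Z2 w := (\sum_(j < n | (j < k)%N) \sum_(i < n | (N <= i)%N) z i j w ^+ 2)%R.
pose a j w := nsq (residual_row N X j w).
pose pen w := \sum_(j < n | (j < k)%N) zero_penalty (a j w).
set C1 := mxnorm rho (A - svd_trunc k U s V).
set C2 := ((1 + gamma) * sigma * gamma ^+ (2 * q))%R.
have sig0 : (0 <= sigma)%R by rewrite sigmaE (@singval_tnth _ _ s N.+1 Nn).
have gam0 : (0 <= gamma)%R by rewrite gammaE divr_ge0// ltW.
have C10 : (0 <= C1)%R := mxnorm_ge0 _ _.
have C20 : (0 <= C2)%R by rewrite !mulr_ge0 ?exprn_ge0// addr_ge0.
have c20 : (0 <= C2 / lam / 2)%R by apply: divr_ge0 => //; apply: divr_ge0 => //; exact: ltW.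
have Z20 w : (0 <= Z2 w)%R.
  by apply: sumr_ge0 => j _; apply: sumr_ge0 => i _; exact: sqr_ge0.
have pen0 w : 0 <= pen w by apply: sume_ge0 => j _; exact: zero_penalty_ge0.
pose B w := (C1 + C2 * lam / 2)%:E + (C2 / lam / 2)%:E * (Z2 w)%:E + pen w.
have zE w i j : z i j w = (V^T *m sample_mx Omega w *m dual_row N X j w) i 0%R.
  by rewrite [RHS]mxE.
have errB w : (mxnorm rho (A - Ahat w))%:E <= B w.
  have [good|] := pselect (forall j : 'I_n, (j < k)%N -> a j w != 0%R); last first.
    move=> /existsNP[j /not_implyP[jk /negP]]; rewrite negbK => aj0.
    suff -> : B w = +oo by rewrite leey.
    rewrite /B /pen (bigD1 j)//= /zero_penalty aj0.
    rewrite addye; first by rewrite -EFinM -EFinD addey// gt_eqF// ltNyr.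
    rewrite gt_eqF// (lt_le_trans ltNy0)//.
    by apply: sume_ge0 => i _; exact: zero_penalty_ge0.
  apply: (@le_trans _ _ ((C1 + C2 * lam / 2)%:E + (C2 / lam / 2)%:E * (Z2 w)%:E));
    last by rewrite leeDl.
  rewrite -EFinM -EFinD lee_fin.
  have := @sor_svd_power_error _ _ _ _ _ _ _ _ _ _ _ _ _ (fun j => dual_row N X j w)
    rho _ _ svdA hkN Nn sk0 (hAhat w) _ sigmaE gammaE.
  have hw (i j : 'I_n) : (j < k)%N -> (i < N)%N ->
      ((V^T *m sample_mx Omega w *m dual_row N X j w) i 0 = (i == j)%:R)%R.
    by move=> jk iN; rewrite -zE /z dual_row_biorthogonal//; exact: good.
  move=> /(_ hw); rewrite -/C1 -/C2.
  have -> : (\sum_(j < n | (j < k)%N) \sum_(i < n | (N <= i)%N)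
      (V^T *m sample_mx Omega w *m dual_row N X j w) i 0 ^+ 2 = Z2 w)%R.
    by apply: eq_bigr => j _; apply: eq_bigr => i _; rewrite zE.
  move=> h; apply: le_trans h _; rewrite -addrA lerD2l.
  (* AM-GM: [Z <= (lam + Z^2 / lam) / 2] *)
  set Z := Num.sqrt _; have Z2E : (Z2 w = Z ^+ 2)%R by rewrite sqr_sqrtr.
  rewrite Z2E -subr_ge0.
  have -> : (C2 * lam / 2 + C2 / lam / 2 * Z ^+ 2 - C2 * Z =
      C2 / lam / 2 * (lam - Z) ^+ 2)%R by field; rewrite gt_eqF.
  exact: mulr_ge0 c20 (sqr_ge0 _).
have mres j : measurable_mx (residual_row N X j).
  apply: measurable_mx_mul.
    by apply: measurable_other_proj => b c _ _; exact: gX.1.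
  by apply: measurable_rowvec => c; exact: gX.1.
have mz i j : measurable_fun setT (z i j).
  apply: measurable_sum => c; apply: measurable_funM; first exact: gX.1.
  have md : measurable_mx (dual_row N X j).
    apply: measurable_mx_scale; last exact: mres.
    apply: (measurableT_comp (@measurable_invr R)).
    by apply: measurable_nsq; exact: mres.
  exact: md.
(* The expectation becomes an integral of a nonnegative, possibly non-measurable function;
   monotonicity replaces it by the measurable [B], and every later step concerns [B]. *)
rewrite unlock.
apply: (@le_trans _ _ (\int[P]_w B w)).
  apply: ge0_le_integralT => w //; rewrite lee_fin; exact: mxnorm_ge0.
have mzp j : measurable_fun setT (fun w => zero_penalty (a j w)).
  apply: (measurableT_comp (@measurable_zero_penalty R)).
  by apply: measurable_nsq; exact: mres.
pose Jk := seq.filter (fun j : 'I_n => (j < k)%N) (index_enum _).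
pose JN := seq.filter (fun i : 'I_n => (N <= i)%N) (index_enum _).
have mpen : measurable_fun setT pen.
  rewrite /pen (_ : (fun w => _) =
    fun w => \sum_(j <- Jk) zero_penalty (a j w)).
    exact: emeasurable_sum.
  by apply/funext => w; rewrite big_filter.
have mz2 : measurable_fun setT Z2.
  rewrite /Z2 (_ : (fun w => _) = fun w =>
      (\sum_(j <- Jk)
        \sum_(i <- JN) z i j w ^+ 2)%R).
    apply: measurable_sum => j; apply: measurable_sum => i.
    exact: measurable_funX.
  apply/funext => w; rewrite big_filter; apply: eq_bigr => j _.
  by rewrite big_filter.
have Epen : \int[P]_w pen w = 0.
  rewrite /pen; under eq_integral do rewrite -big_filter.
  rewrite ge0_integral_sum//; last by move=> j w _; exact: zero_penalty_ge0.
  rewrite big_filter big1// => j jk; apply: gaussian_residual_null => //.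
  - exact: leq_trans kN.
  - by rewrite -Nl; move: (leq_trans k1 kN); case: (N) => // N' _;
      rewrite /= -addn1 leq_add2l.
have EZ2 : \int[P]_w (Z2 w)%:E <= (lam ^+ 2)%:E.
  rewrite (_ : (fun w => _) = fun w =>
      \sum_(j <- Jk)
        \sum_(i <- JN) (z i j w ^+ 2)%:E); last first.
    apply/funext => w; rewrite /Z2 -sumEFin big_filter; apply: eq_bigr => j _.
    by rewrite -sumEFin big_filter.
  have z0 i j w : 0 <= (z i j w ^+ 2)%:E by rewrite lee_fin sqr_ge0.
  have mz2ij i j : measurable_fun setT (fun w => (z i j w ^+ 2)%:E).
    by apply/measurable_EFinP; exact: measurable_funX.
  rewrite ge0_integral_sum//; last 2 first.
  - by move=> j; apply: emeasurable_sum => i.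
  - by move=> j w _; apply: sume_ge0 => i _.
  under eq_bigr do rewrite ge0_integral_sum//.
  apply: (@le_trans _ _ (\sum_(j < n | (j < k)%N) \sum_(i < n | (N <= i)%N)
      (6 / r.+1%:R : R)%:E)).
    rewrite big_filter; apply: lee_sum => j jk.
    rewrite big_filter; apply: lee_sum => i Ni.
    by apply: (gaussian_tail_sqr gX) => //; exact: leq_trans kN.
  under eq_bigr do rewrite sumEFin.
  by rewrite sumEFin lee_fin sum_ord_ge_const ?(ltnW Nn)// sum_ord_lt_const.
have mB1 : measurable_fun setT (fun w => (C2 / lam / 2)%:E * (Z2 w)%:E).
  by apply: emeasurable_funM => //; exact/measurable_EFinP.
have cst0 : (0 <= C1 + C2 * lam / 2)%R.
  by apply: addr_ge0 => //; apply: divr_ge0 => //; apply: mulr_ge0 => //; exact: ltW.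
have cZ0 w : (0 <= C2 / lam / 2 * Z2 w)%R := mulr_ge0 c20 (Z20 w).
rewrite /B ge0_integralD//; last 2 first.
- by move=> w _; rewrite -EFinM -EFinD lee_fin (addr_ge0 cst0 (cZ0 w)).
- exact: (emeasurable_funD (measurable_cst _) mB1).
rewrite Epen adde0 ge0_integralD//; last by move=> w _; rewrite -EFinM lee_fin cZ0.
rewrite integral_cst// [X in _ * X]probability_setT mule1.
rewrite ge0_integralZl//; last 2 first.
- exact/measurable_EFinP.
- by move=> w _; rewrite lee_fin Z20.
apply: (@le_trans _ _ ((C1 + C2 * lam / 2)%:E + (C2 / lam / 2)%:E * (lam ^+ 2)%:E)).
  by apply: leeD => //; apply: lee_wpmul2l.
rewrite -EFinM -EFinD lee_fin.
suff -> : (C1 + C2 * lam / 2 + C2 / lam / 2 * lam ^+ 2 = C1 + C2 * lam)%R by [].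
by field; rewrite gt_eqF.
Qed.

Local Close Scope ereal_scope.

(** To be read with [r = p - 2] and [x = n - l + p]. The first factor of [nu] has a square of at
    least [x]; the second accounts for [6 / (p - 1)], using [expR 1 >= 2] and [l >= p + 1]. *)
Lemma nu_bound (R : realType) (l r x : nat) : (r + 3 <= l)%N ->
  6 / r.+1%:R * x%:R <=
  ((Num.sqrt x%:R + Num.sqrt l%:R + 7) *
   (4 * expR 1 * Num.sqrt l%:R / (r + 2 + 1)%:R)) ^+ 2 :> R.
Proof.
move=> rl; have e2 : 2 <= expR 1 :> R.
  by apply: le_trans (expR_ge1Dx 1); rewrite -[2]/(1 + 1).
have r0 : 0 < r.+1%:R :> R by rewrite ltr0n.
have p0 : 0 < (r + 2 + 1)%:R :> R by rewrite ltr0n addn1.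
have pE : (r + 2 + 1)%:R = r.+1%:R + 2 :> R by rewrite -natrD; congr _%:R; lia.
have r1 : 1 <= r.+1%:R :> R by rewrite ler1n.
have lE : (r + 2 + 1)%:R <= l%:R :> R by rewrite ler_nat -addnA.
have sx : 0 <= Num.sqrt x%:R :> R := sqrtr_ge0 _.
have sl : 0 <= Num.sqrt l%:R :> R := sqrtr_ge0 _.
rewrite exprMn mulrC; apply: ler_pM => //.
- rewrite -[leLHS]sqr_sqrtr//; apply: lerXn2r; rewrite ?nnegrE//; lra.
rewrite expr_div_n exprMn sqr_sqrtr// ler_pdivlMr ?exprn_gt0//.
rewrite mulrAC ler_pdivrMr//.
move: pE lE r1 e2; move: (expR 1) (r.+1%:R) ((r + 2 + 1)%:R) (l%:R) => e t pp L pE lE t1 e2.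
have e4 : 4 <= e ^+ 2 by nra.
(* 64 is [4^2 * 2^2], from [e >= 2], and [L >= pp] supplies the factor [pp]. It remains that
   [6 * pp <= 64 * t], where [pp = t + 2] and [t >= 1]. *)
have h1 : 64 * (pp * t) <= (4 * e) ^+ 2 * L * t.
  have : 64 * pp <= (4 * e) ^+ 2 * L by rewrite exprMn; nra.
  nra.
nra.
Qed.

Theorem theorem7 (R : realType) (d : measure_display) (T : measurableType d)
    (P : probability T R) (m n k l p : nat)
    (hmn : (n <= m)%N) (hn : (maxn k 2 < n)%N) (hl : (k <= l < n)%N)
    (hk : (1 <= k)%N) (hp : (2 <= p <= l - k)%N)
    (A : 'M[R]_(m, n)) (U : 'M[R]_(m, n)) (s : n.-tuple R) (V : 'M[R]_n)
    (hsvd : is_svd A U s V) (hsk : 0 < singval s k)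
    (Omega : 'I_n -> 'I_l -> {RV P >-> R})
    (hOmega : standard_gaussian_mx Omega)
    (rho : norm_kind) :
  let A0 := A - svd_trunc k U s V in
  let sigma := singval s (l - p + 1) in
  let gamma := sigma / singval s k in
  let nu1 := Num.sqrt (n - l + p)%:R + Num.sqrt l%:R + 7 in
  let nu2 := 4 * expR 1 * Num.sqrt l%:R / (p + 1)%:R in
  let nu := nu1 * nu2 in
  (forall Ahat : T -> 'M[R]_(m, n),
    (forall w, sor_svd k A (sample_mx Omega w) (Ahat w)) ->
    ('E_P[fun w => mxnorm rho (A - Ahat w)] <=
     (mxnorm rho A0 + (1 + gamma) * Num.sqrt k%:R * nu * sigma)%:E)%E) /\
  (forall (q : nat) (Ahat : T -> 'M[R]_(m, n)),
    (forall w, sor_svd_power k q A (sample_mx Omega w) (Ahat w)) ->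
    ('E_P[fun w => mxnorm rho (A - Ahat w)] <=
     (mxnorm rho A0 +
      (1 + gamma) * Num.sqrt k%:R * nu * sigma * gamma ^+ (2 * q))%:E)%E).
Proof.
move=> A0 sigma gamma nu1 nu2 nu.
have power q (Ahat : T -> 'M[R]_(m, n)) :
    (forall w, sor_svd_power k q A (sample_mx Omega w) (Ahat w)) ->
    ('E_P[fun w => mxnorm rho (A - Ahat w)] <=
     (mxnorm rho A0 +
      (1 + gamma) * Num.sqrt k%:R * nu * sigma * gamma ^+ (2 * q))%:E)%E.
  move=> hAhat; have [p2 plk] := andP hp; have [kl ln] := andP hl.
  (* The [N - 1] other rows leave [l - (N - 1) = p + 1 = r + 3] free dimensions, whence the inverse
     moment [1 / (r + 1) = 1 / (p - 1)]. *)
  pose N := (l - p)%N; pose r := (p - 2)%N.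
  have kN : (1 <= k <= N)%N by rewrite hk /N; lia.
  have Nn : (N < n)%N by rewrite /N; lia.
  have Nl : (N.-1 + r.+3)%N = l by rewrite /N /r; lia.
  have rl : (r + 3 <= l)%N by rewrite /r; lia.
  have pE : (r + 2)%N = p by rewrite /r; lia.
  have nE : (n - N)%N = (n - l + p)%N by rewrite /N; lia.
  have sigE : sigma = singval s N.+1 by rewrite /sigma addn1.
  have l0 : (0 < l)%N by lia.
  have lam0 : 0 < Num.sqrt k%:R * nu.
    rewrite mulr_gt0 ?sqrtr_gt0 ?ltr0n// mulr_gt0//.
      by rewrite ltr_wpDl// addr_ge0 ?sqrtr_ge0.
    by rewrite !mulr_gt0 ?expR_gt0 ?sqrtr_gt0 ?invr_gt0 ?ltr0n// addn1.
  have lamE : 6 / r.+1%:R * (n - N)%:R * k%:R <= (Num.sqrt k%:R * nu) ^+ 2.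
    rewrite exprMn sqr_sqrtr ?ler0n// mulrC; apply: ler_wpM2l => //.
    by have := nu_bound R (n - l + p) rl; rewrite pE nE.
  have := expectation_error_le rho hsvd kN Nn Nl hsk hOmega hAhat sigE erefl lam0 lamE.
  rewrite -/A0 -/gamma; congr (_ <= (_ + _)%:E)%E; ring.
(* The basic algorithm is the power scheme at [q = 0], where the factor [gamma ^+ (2 * q)] is 1. *)
split=> [Ahat hAhat|]; last exact: power.
have := power 0%N Ahat (fun w => sor_svd_power0 (hAhat w)).
by rewrite muln0 expr0 mulr1.
Qed.
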